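(* (Cellular approximation.) Let $M$ be a monoid and let $f\colon X\to Y$ be a continuous $M$-equivariant mapping, where $X$ is a projective $M$-CW complex and $Y$ is a CW complex with a continuous action of $M$ by cellular mappings. Then $f$ is $M$-homotopic to a continuous $M$-equivariant cellular mapping. Moreover, any two such cellular approximations of $f$ (continuous $M$-equivariant cellular mappings that are $M$-homotopic to $f$) are homotopic via a cellular $M$-homotopy.
   Context: Let $M$ be a monoid with the discrete topology. An $M$-set $P$ (set with left $M$-action) is projective if every surjective $M$-equivariant map onto $P$ has an $M$-equivariant section; equivalently $P\cong\coprod_{a\in A}Me_a$ with each $e_a\in M$ idempotent. An $M$-space is a topological space with a continuous left action of $M$; $M$-sets are regarded as discrete $M$-spaces. $I=[0,1]$, $B^n$ and $S^{n-1}=\partial B^n$ carry trivial $M$-actions. A projective $M$-CW complex is an $M$-space $X=\varinjlim X_n$ (along inclusions) where $X_0=P_0$ is a projective $M$-set and, for $n\ge1$, $X_n$ is a pushout of $M$-spaces $X_n=X_{n-1}\cup_{P_n\times S^{n-1}}(P_n\times B^n)$ along an $M$-equivariant continuous map $P_n\times S^{n-1}\to X_{n-1}$, with $P_n$ a projective $M$-set. Such an $X$ is in particular a CW complex with $n$-skeleton $X_n$, and $X\times I$ is again a projective $M$-CW complex with the product cell structure. A map of CW complexes is cellular if it maps the $n$-skeleton into the $n$-skeleton for every $n$. An $M$-homotopy between $M$-equivariant continuous maps $f,g\colon X\to Y$ is an $M$-equivariant continuous map $H\colon X\times I\to Y$ with $H(x,0)=f(x)$ and $H(x,1)=g(x)$;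 it is cellular if $H$ is a cellular map. *)

(* Defs.v *)
From mathcomp Require Import all_boot all_order all_algebra monoid.
From mathcomp Require Import all_classical all_reals all_analysis.

Set Implicit Arguments.
Unset Strict Implicit.
Unset Printing Implicit Defensive.

Import Order.TTheory GRing.Theory Num.Theory.
Import numFieldNormedType.Exports.

Local Open Scope classical_set_scope.
Local Open Scope ring_scope.

(* Pushouts and sequential colimits, by their universal property, in a
   category whose objects have underlying types and whose morphisms are
   functions between these. *)
Record concrete_category := ConcreteCategory {
  cat_ob :> Type;
  cat_el : cat_ob -> Type;
  cat_hom : forall A B : cat_ob, (cat_el A -> cat_el B) -> Prop;
  cat_hom_id : forall A : cat_ob, cat_hom (@idfun (cat_el A));
  cat_hom_comp : forall (A B C : cat_ob)
    (g : cat_el B -> cat_el C) (f : cat_el A -> cat_el B),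
    cat_hom g -> cat_hom f -> cat_hom (g \o f)
}.

Definition is_iso (C : concrete_category) (A B : C)
    (f : cat_el A -> cat_el B) : Prop :=
  cat_hom f /\ exists2 g, cat_hom g & cancel f g /\ cancel g f.

(*      f          The square commutes and is universal: a compatible pair
    A ----> X     (u : X -> Z, v : B -> Z) factors uniquely through X'.
  i |       | j
    v   g   v
    B ----> X'                                                             *)
Definition is_pushout (C : concrete_category) (A B X X' : C)
    (i : cat_el A -> cat_el B) (f : cat_el A -> cat_el X)
    (j : cat_el X -> cat_el X') (g : cat_el B -> cat_el X') : Prop :=
  [/\ cat_hom i, cat_hom f, cat_hom j & cat_hom g] /\
  j \o f = g \o i /\
  forall (Z : C) (u : cat_el X -> cat_el Z) (v : cat_el B -> cat_el Z),
    cat_hom u -> cat_hom v -> u \o f = v \o i ->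
    exists! w : cat_el X' -> cat_el Z,
      [/\ cat_hom w, w \o j = u & w \o g = v].

Definition is_sequential_colimit (C : concrete_category) (S : nat -> C)
    (s : forall n, cat_el (S n) -> cat_el (S n.+1)) (X : C)
    (c : forall n, cat_el (S n) -> cat_el X) : Prop :=
  (forall n, cat_hom (s n)) /\ (forall n, cat_hom (c n)) /\
  (forall n, c n.+1 \o s n = c n) /\
  forall (Z : C) (u : forall n, cat_el (S n) -> cat_el Z),
    (forall n, cat_hom (u n)) -> (forall n, u n.+1 \o s n = u n) ->
    exists! w : cat_el X -> cat_el Z,
      cat_hom w /\ forall n, w \o c n = u n.

Lemma continuous_idfun (A : topologicalType) : continuous (@idfun A).
Proof. by move=> x. Qed.

Lemma continuous_compose (A B C : topologicalType) (g : B -> C) (f : A -> B) :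
  continuous g -> continuous f -> continuous (g \o f).
Proof. by move=> cg cf x; apply: continuous_comp; [exact: cf|exact: cg]. Qed.

Lemma continuous_pair (A B C : topologicalType) (f : A -> B) (g : A -> C) :
  continuous f -> continuous g -> continuous (fun x => (f x, g x)).
Proof. by move=> cf cg x; apply: cvg_pair; [exact: cf|exact: cg]. Qed.

Definition topological_spaces : concrete_category :=
  @ConcreteCategory topologicalType (fun A => A)
    (fun A B f => continuous f) continuous_idfun continuous_compose.

Record monoid_set (M : monoidType) := MonoidSet {
  mset_sort :> choiceType;
  mset_act : M -> mset_sort -> mset_sort;
  mset_act1 : forall x, mset_act 1%g x = x;
  mset_actM : forall a b x, mset_act (a * b)%g x = mset_act a (mset_act b x)
}.

Definition mset_map (M : monoidType) (P Q : monoid_set M) (f : P -> Q) : Prop :=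
  forall a x, f (mset_act a x) = mset_act a (f x).

Definition projective (M : monoidType) (P : monoid_set M) : Prop :=
  forall (Q : monoid_set M) (q : Q -> P),
    mset_map q -> (forall y, exists x, q x = y) ->
    exists2 s : P -> Q, mset_map s & cancel s q.

Record mspace (M : monoidType) := MSpace {
  mspace_sort :> topologicalType;
  mspace_act : M -> mspace_sort -> mspace_sort;
  mspace_act1 : forall x, mspace_act 1%g x = x;
  mspace_actM : forall a b x,
    mspace_act (a * b)%g x = mspace_act a (mspace_act b x);
  mspace_act_continuous : continuous
    (fun p : discrete_topology M * mspace_sort => mspace_act p.1 p.2)
}.

Definition mspace_map (M : monoidType) (X Y : mspace M) (f : X -> Y) : Prop :=
  continuous f /\ forall a x, f (mspace_act a x) = mspace_act a (f x).

Section mspaces.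
Variable M : monoidType.

Lemma mspace_map_id (X : mspace M) : mspace_map (@idfun X).
Proof. by split => //; exact: continuous_idfun. Qed.

Lemma mspace_map_comp (X Y Z : mspace M) (g : Y -> Z) (f : X -> Y) :
  mspace_map g -> mspace_map f -> mspace_map (g \o f).
Proof.
move=> [cg eg] [cf ef]; split; first exact: continuous_compose.
by move=> a x /=; rewrite ef eg.
Qed.

Definition mspaces : concrete_category :=
  @ConcreteCategory (mspace M) (@mspace_sort M)
    (@mspace_map M) mspace_map_id mspace_map_comp.

Lemma discrete_act_continuous (P : monoid_set M) : continuous
  (fun p : discrete_topology M * discrete_topology P =>
     (mset_act p.1 p.2 : discrete_topology P)).
Proof.
move=> [a x] U /nbhs_singleton Ux; exists ([set a], [set x]) => /=.
  by split; exact: discrete_set1.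
by move=> [b y] [/= -> ->].
Qed.

Definition discrete_mspace (P : monoid_set M) : mspace M :=
  @MSpace M (discrete_topology P) (@mset_act M P)
    (@mset_act1 M P) (@mset_actM M P) (@discrete_act_continuous P).

Lemma trivial_act_continuous (B : topologicalType) : continuous
  (fun p : discrete_topology M * B => p.2).
Proof. by move=> p; exact: cvg_snd. Qed.

Definition trivial_mspace (B : topologicalType) : mspace M :=
  @MSpace M B (fun _ x => x) (fun _ => erefl) (fun _ _ _ => erefl)
    (@trivial_act_continuous B).

Section product.
Variables X Y : mspace M.

Definition prod_act (a : M) (p : X * Y) : X * Y :=
  (mspace_act a p.1, mspace_act a p.2).

Lemma prod_act1 p : prod_act 1%g p = p.
Proof. by case: p => x y; rewrite /prod_act !mspace_act1. Qed.

Lemma prod_actM a b p : prod_act (a * b)%g p = prod_act a (prod_act b p).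
Proof. by rewrite /prod_act !mspace_actM. Qed.

Lemma prod_act_continuous : continuous
  (fun p : discrete_topology M * (X * Y) => prod_act p.1 p.2).
Proof.
have cX : continuous
    (fun p : discrete_topology M * (X * Y) => mspace_act p.1 p.2.1 : X).
  apply: (continuous_compose (@mspace_act_continuous M X)
    (f := fun p : discrete_topology M * (X * Y) => (p.1, p.2.1))).
  apply: continuous_pair => p; first exact: cvg_fst.
  by apply: (@cvg_comp _ _ _ snd fst); [exact: cvg_snd|exact: cvg_fst].
have cY : continuous
    (fun p : discrete_topology M * (X * Y) => mspace_act p.1 p.2.2 : Y).
  apply: (continuous_compose (@mspace_act_continuous M Y)
    (f := fun p : discrete_topology M * (X * Y) => (p.1, p.2.2))).
  apply: continuous_pair => p; first exact: cvg_fst.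
  by apply: (@cvg_comp _ _ _ snd snd); [exact: cvg_snd|exact: cvg_snd].
exact: continuous_pair cX cY.
Qed.

Definition prod_mspace : mspace M :=
  @MSpace M (X * Y)%type prod_act prod_act1 prod_actM prod_act_continuous.

End product.
End mspaces.

Section cw.
Variable R : realType.

(* The norm of 'rV[R]_n in the library is the sup norm, hence the explicit
   sums of squares. *)
Definition ball_set n : set 'rV[R]_n := [set x | \sum_(i < n) x 0 i ^+ 2 <= 1].
Definition sphere_set n : set 'rV[R]_n := [set x | \sum_(i < n) x 0 i ^+ 2 = 1].

(* B^n and S^(n-1), with the subspace topologies of R^n. *)
Definition Ball n : topologicalType := set_type (@ball_set n).
Definition Sphere n : topologicalType := set_type (@sphere_set n).

Lemma sphere_sub_ball n : @sphere_set n `<=` @ball_set n.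
Proof. by move=> x; rewrite /sphere_set /ball_set /= => ->. Qed.

Definition sphere_incl n (x : Sphere n) : Ball n :=
  exist _ (sval x) (mem_set (sphere_sub_ball (set_mem (svalP x)))).

Definition cell_incl (P : Type) n (p : P * Sphere n) : P * Ball n :=
  (p.1, sphere_incl p.2).

(* In both structures below, cells n indexes the n-cells, and the cells of
   dimension n.+1 are attached to skel_space n along attach n. The space
   skel_space n is carried into X by incl n. *)
Record cw_complex (X : topologicalType) := CWComplex {
  cw_cells : nat -> choiceType;
  cw_skel_space : nat -> topologicalType;
  cw_base : discrete_topology (cw_cells 0) -> cw_skel_space 0;
  cw_step : forall n, cw_skel_space n -> cw_skel_space n.+1;
  cw_attach : forall n,
    discrete_topology (cw_cells n.+1) * Sphere n.+1 -> cw_skel_space n;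
  cw_char : forall n,
    discrete_topology (cw_cells n.+1) * Ball n.+1 -> cw_skel_space n.+1;
  cw_incl : forall n, cw_skel_space n -> X;
  cw_baseP : @is_iso topological_spaces
    (discrete_topology (cw_cells 0)) (cw_skel_space 0) cw_base;
  cw_pushout : forall n, @is_pushout topological_spaces
    (discrete_topology (cw_cells n.+1) * Sphere n.+1)%type
    (discrete_topology (cw_cells n.+1) * Ball n.+1)%type
    (cw_skel_space n) (cw_skel_space n.+1)
    (@cell_incl _ n.+1) (@cw_attach n) (@cw_step n) (@cw_char n);
  cw_colimit : @is_sequential_colimit topological_spaces
    cw_skel_space cw_step X cw_incl
}.

Definition cw_skeleton (X : topologicalType) (K : cw_complex X) (n : nat) :
  set X := range (@cw_incl X K n).

Section projective_mcw.
Variable M : monoidType.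

Definition mcell (P : monoid_set M) (B : topologicalType) : mspace M :=
  prod_mspace (discrete_mspace P) (trivial_mspace M B).

Record projective_mcw_complex (X : mspace M) := ProjectiveMCWComplex {
  mcw_cells : nat -> monoid_set M;
  mcw_cells_projective : forall n, projective (mcw_cells n);
  mcw_skel_space : nat -> mspace M;
  mcw_base : discrete_mspace (mcw_cells 0) -> mcw_skel_space 0;
  mcw_step : forall n, mcw_skel_space n -> mcw_skel_space n.+1;
  mcw_attach : forall n,
    mcell (mcw_cells n.+1) (Sphere n.+1) -> mcw_skel_space n;
  mcw_char : forall n,
    mcell (mcw_cells n.+1) (Ball n.+1) -> mcw_skel_space n.+1;
  mcw_incl : forall n, mcw_skel_space n -> X;
  mcw_baseP : @is_iso (mspaces M)
    (discrete_mspace (mcw_cells 0)) (mcw_skel_space 0) mcw_base;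
  mcw_pushout : forall n, @is_pushout (mspaces M)
    (mcell (mcw_cells n.+1) (Sphere n.+1)) (mcell (mcw_cells n.+1) (Ball n.+1))
    (mcw_skel_space n) (mcw_skel_space n.+1)
    (@cell_incl _ n.+1) (@mcw_attach n) (@mcw_step n) (@mcw_char n);
  mcw_colimit : @is_sequential_colimit (mspaces M)
    mcw_skel_space mcw_step X mcw_incl
}.

Definition mcw_skeleton (X : mspace M) (K : projective_mcw_complex X)
  (n : nat) : set X := range (@mcw_incl X K n).

End projective_mcw.

Definition unit_interval : set R := `[0, 1]%classic.
Definition I01 : topologicalType := set_type unit_interval.

Lemma unit_interval0 : unit_interval 0.
Proof. by rewrite /unit_interval /= in_itv /= lexx ler01. Qed.

Lemma unit_interval1 : unit_interval 1.
Proof. by rewrite /unit_interval /= in_itv /= lexx ler01. Qed.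

Definition I0 : I01 := exist _ 0 (mem_set unit_interval0).
Definition I1 : I01 := exist _ 1 (mem_set unit_interval1).

Definition I_skeleton (n : nat) : set I01 :=
  if n is 0%N then [set I0; I1] else setT.

Definition prod_skeleton (X Y : Type) (A : nat -> set X) (B : nat -> set Y)
    (n : nat) : set (X * Y) :=
  \bigcup_(k in [set k | (k <= n)%N]) (A k `*` B (n - k)%N).

Definition cellular (X Y : Type) (A : nat -> set X) (B : nat -> set Y)
    (f : X -> Y) : Prop :=
  forall n, f @` A n `<=` B n.

Section homotopy.
Variable M : monoidType.

Definition cylinder (X : mspace M) : mspace M :=
  prod_mspace X (trivial_mspace M I01).

Definition is_mhomotopy (X Y : mspace M) (f g : X -> Y)
    (H : cylinder X -> Y) : Prop :=
  [/\ mspace_map H, forall x, H (x, I0) = f x & forall x, H (x, I1) = g x].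

Definition mhomotopic (X Y : mspace M) (f g : X -> Y) : Prop :=
  exists H : cylinder X -> Y, is_mhomotopy f g H.

Definition cellular_approximation (X Y : mspace M)
    (KX : projective_mcw_complex X) (KY : cw_complex Y) (f g : X -> Y) : Prop :=
  [/\ mspace_map g, cellular (mcw_skeleton KX) (cw_skeleton KY) g
    & mhomotopic f g].

End homotopy.
End cw.

(* Main.v *)
From HB Require Import structures.
Require Import Defs.
From mathcomp Require Import all_boot all_order all_algebra monoid.
From mathcomp Require Import all_classical all_reals all_analysis.
From mathcomp Require Import lra ring.

(** The proof follows the classical one, arranged so that it only uses the
    universal properties of the skeleta.

    The core is the compression of a map [phi] from a compact space [D] of
    dimension at most [k] to a CW complex [Y] into the [n]-skeleton, for
    [k <= n], relative to the points that [phi] already sends there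
    ([compress]). By compactness [phi] lands in a finite skeleton
    ([cw_compact_skeleton]), so it is enough to go from dimension [m+1] to
    dimension [m] when [k < m+1] ([compress_step]). In the coordinates of the
    open [(m+1)]-cells, [phi] is a map to a Euclidean space of dimension larger
    than that of [D]. A Lipschitz approximation of it misses a point, by
    counting ([approx_missing_point]). Following a segment in each cell, one
    replaces [phi] by this approximation and pushes it from the missed point
    to the boundary of the cell. The coordinates are used in all cells at
    once, and one missed point serves them all.

    A homotopy given on the boundary of a cell is extended over the cell and
    compressed at the same time ([cell_homotopy]). If [P] is projective, a
    section of the free [M]-set that covers [P] writes every [p] in [P] as the
    translate by [c p] of a representative [u p]. Homotopies that
    are chosen for the representatives are translated to all cells
    ([deformationS]); as [M] acts on [Y] by cellular maps, the skeleta are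
    preserved. Skeleton by skeleton this deforms any equivariant map
    [X * T -> Y] with a compact parameter space [T]
    ([equivariant_deformation]). Homotopies on a pushout or a colimit are
    obtained from the compact-open exponential, and the universal properties
    among [M]-spaces yield those among spaces because the forgetful functor
    has a right adjoint ([forget_pushout], [forget_colimit]).

    With [T] a point this gives a cellular approximation. For the uniqueness,
    two approximations are joined by a homotopy [H] through [f]. Deforming [H]
    with [T] the interval makes it cellular, and moves each of its two ends
    by a homotopy that stays within the allowed skeleta; composing these
    homotopies with the deformed [H] gives a cellular homotopy between the
    original approximations. *)

Set Implicit Arguments.
Unset Strict Implicit.
Unset Printing Implicit Defensive.

Import Order.TTheory GRing.Theory Num.Theory.
Import numFieldNormedType.Exports.

Local Open Scope classical_set_scope.
Local Open Scope ring_scope.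

(** * Topology of products and subspaces *)

Lemma discrete_locally_compact (T : choiceType) :
  locally_compact [set: discrete_topology T].
Proof.
move=> x _; exists [set x]; first by rewrite withinET; exact: discrete_set1.
by split; [exact: compact_set1|exact: discrete_closed].
Qed.

Lemma discrete_prod_continuous (D : choiceType) (U V : topologicalType)
    (f : discrete_topology D * U -> V) :
  (forall d, continuous (fun u => f (d, u))) -> continuous f.
Proof.
move=> cf [d u] W /(cf d u) dW; exists ([set d], [set u | W (f (d, u))]).
  by split => //=; exact: discrete_set1.
by move=> [e w] [/= -> ].
Qed.

Lemma discrete_continuous (D : choiceType) (V : topologicalType)
    (f : discrete_topology D -> V) : continuous f.
Proof.
by apply/continuousP => W _; exact: discrete_open.
Qed.

Lemma discrete_prod_closed (D : choiceType) (U : topologicalType)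
    (C : set (discrete_topology D * U)) :
  (forall d, closed [set u | C (d, u)]) -> closed C.
Proof.
move=> clC [d u] Cdu; apply: (clC d) => W Wu.
have [|[e w] [Cew [/= ed Ww]]] := Cdu ([set d] `*` W).
  by exists ([set d], W) => //; split => //; exact: discrete_set1.
by exists w; rewrite -ed.
Qed.

Lemma continuous_fst (A B Z : topologicalType) (f : A -> Z) :
  continuous f -> continuous (fun p : A * B => f p.1).
Proof. by move=> cf; apply: (continuous_compose cf) => p; exact: cvg_fst. Qed.

Lemma continuous_snd (A B Z : topologicalType) (f : B -> Z) :
  continuous f -> continuous (fun p : A * B => f p.2).
Proof. by move=> cf; apply: (continuous_compose cf) => p; exact: cvg_snd. Qed.

(** Continuity of [f] and [g] is local to [A] and [B] so that [g] may involve the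
    normalization of a vector, which is discontinuous at 0. *)
Lemma glue_continuous (X Z : topologicalType) (A B : set X) (f g h : X -> Z) :
  closed A -> closed B -> (forall x, A x \/ B x) ->
  (forall x, A x -> {for x, continuous f}) ->
  (forall x, B x -> {for x, continuous g}) ->
  (forall x, A x -> h x = f x) -> (forall x, B x -> h x = g x) ->
  continuous h.
Proof.
move=> clA clB AB cf cg hf hg.
have part (E : set X) (k : X -> Z) : closed E ->
    (forall x, E x -> {for x, continuous k}) -> forall C, closed C ->
    closed (E `&` k @^-1` C).
  move=> clE ck C clC x clx.
  have Ex : E x by apply: clE => W /clx[y [[Ey _] Wy]]; exists y.
  split=> //; apply: clC => W kW.
  by have [y [[_ Cy] Wy]] := clx _ (ck x Ex _ kW); exists (k y).
apply/continuous_closedP => C clC.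
rewrite (_ : _ @^-1` _ = (A `&` f @^-1` C) `|` (B `&` g @^-1` C)).
  by apply: closedU; exact: part.
apply/seteqP; split => x /=.
  by have [Ax|Bx] := AB x; [rewrite hf //; left|rewrite hg //; right].
by case=> -[Ax]; [rewrite hf|rewrite hg].
Qed.

Lemma cluster_continuous (X Z : topologicalType) (f : X -> Z) (p q : X) :
  continuous f -> cluster (nbhs p) q -> cluster (nbhs (f p)) (f q).
Proof.
move=> cf pq A B /cf fA /cf fB.
by have [x [Ax Bx]] := pq _ _ fA fB; exists (f x).
Qed.

Lemma hausdorff_injective (X Z : topologicalType) (f : X -> Z) :
  continuous f -> injective f -> hausdorff_space Z -> hausdorff_space X.
Proof. by move=> cf fI hZ p q /(cluster_continuous cf)/hZ/fI. Qed.

Lemma hausdorff_prod (X Z : topologicalType) :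
  hausdorff_space X -> hausdorff_space Z -> hausdorff_space (X * Z)%type.
Proof.
move=> hX hZ [p1 p2] [q1 q2] pq.
have fstc : continuous (@fst X Z) by move=> x; exact: cvg_fst.
have sndc : continuous (@snd X Z) by move=> x; exact: cvg_snd.
have /= -> := hX _ _ (cluster_continuous fstc pq).
by have /= -> := hZ _ _ (cluster_continuous sndc pq).
Qed.

Lemma compact_prod (X Z : topologicalType) :
  compact [set: X] -> compact [set: Z] -> compact [set: (X * Z)%type].
Proof. by move=> cX cZ; rewrite -setXTT; exact: compact_setX. Qed.

Lemma compact_set_type (X : topologicalType) (A : set X) :
  compact A -> compact [set: set_type A].
Proof.
move=> cA F FF _.
have FA : F (set_val @^-1` A).
  by apply: (@filterS _ F _ setT) filterT => x _; exact: set_mem (svalP x).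
have [p [Ap clp]] := cA (set_val @ F) _ FA.
exists (exist _ p (mem_set Ap)); split => // U V FU [_ [[W oW <-] /= Wp WV]].
have [||_ [[u Uu <-] Wu]] := clp (set_val @` U) W.
- by apply: (@filterS _ F _ U) FU => u Uu; exists u.
- by apply: open_nbhs_nbhs.
by exists u; split => //; exact: WV.
Qed.

Lemma set_val_continuous (X : topologicalType) (A : set X) :
  continuous (set_val : set_type A -> X).
Proof. exact: initial_continuous. Qed.

Lemma set_type_continuous (X Z : topologicalType) (A : set X)
    (f : Z -> set_type A) : continuous (set_val \o f) -> continuous f.
Proof.
move=> /continuousP cf; apply/continuousP => _ [U oU <-].
by rewrite -comp_preimage; exact: cf.
Qed.

Lemma set_type_hausdorff (X : topologicalType) (A : set X) :
  hausdorff_space X -> hausdorff_space (set_type A).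
Proof.
by apply: (hausdorff_injective (@set_val_continuous X A)); exact: val_inj.
Qed.

Lemma compact_locally_compact (X : topologicalType) :
  compact [set: X] -> locally_compact [set: X].
Proof.
move=> cX x _; exists setT; first by rewrite withinET; exact: filterT.
by split => //; exact: closedT.
Qed.

(** * Pushouts and sequential colimits of spaces *)

Definition indiscrete_bool : topologicalType :=
  initial_topology (fun _ : bool => 0%N).

Lemma indiscrete_continuous (T : topologicalType) (h : T -> indiscrete_bool) :
  continuous h.
Proof.
apply/continuousP => _ [U _ <-]; have [U0|U0] := pselect (U 0%N).
  by rewrite (_ : _ @^-1` _ = setT); [exact: openT|rewrite -subTset => t _].
by rewrite (_ : _ @^-1` _ = set0); [exact: open0|rewrite -subset0 => t].
Qed.

(** Two maps to a two-point indiscrete space that agree on the images of [j]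
    and [g] are equal, since both solve the same factorization problem; this
    applies to the indicator of the union of these images and to the constant
    [true]. *)
Lemma pushout_cover (A B X X' : topologicalType) (i : A -> B) (f : A -> X)
    (j : X -> X') (g : B -> X') :
  @is_pushout topological_spaces A B X X' i f j g ->
  forall x', (exists x, x' = j x) \/ (exists b, x' = g b).
Proof.
move=> [_ [sq univ]] x'.
pose Z := indiscrete_bool.
pose h : X' -> Z := fun x' =>
  `[<(exists x, x' = j x) \/ (exists b, x' = g b)>].
pose k : X' -> Z := fun=> true.
have [|||w [_ uniq]] := univ Z (k \o j) (k \o g);
  [exact: indiscrete_continuous|exact: indiscrete_continuous|by []|].
have wk : w = k by apply: uniq; split => //; exact: indiscrete_continuous.
have wh : w = h.
  apply: uniq; split; first exact: indiscrete_continuous.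
    by apply/funext => x; apply/asboolT; left; exists x.
  by apply/funext => b; apply/asboolT; right; exists b.
apply/asboolP; exact: (congr1 (fun F => F x') (etrans (esym wh) wk)).
Qed.

Lemma colimit_cover (S : nat -> topologicalType)
    (s : forall n, S n -> S n.+1) (X : topologicalType)
    (c : forall n, S n -> X) :
  @is_sequential_colimit topological_spaces S s X c ->
  forall x, exists n y, x = c n y.
Proof.
move=> [_ [_ [sc univ]]] x.
pose Z := indiscrete_bool.
pose h : X -> Z := fun x => `[<exists n y, x = c n y>].
pose k : X -> Z := fun=> true.
have [||w [_ uniq]] := univ Z (fun n => k \o c n); [by move=> n; exact: indiscrete_continuous|by []|].
have wk : w = k by apply: uniq; split => //; exact: indiscrete_continuous.
have wh : w = h.
  apply: uniq; split; first exact: indiscrete_continuous.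
  by move=> n; apply/funext => y; apply/asboolT; exists n, y.
apply/asboolP; exact: (congr1 (fun F => F x) (etrans (esym wh) wk)).
Qed.

(** Taking the product with a locally compact Hausdorff space [V] is left
    adjoint to the compact-open exponential, so it preserves pushouts. Only the
    existence of a common extension of [u] and [v] is recorded. *)
Lemma pushout_times (V : topologicalType) (A B X X' : topologicalType)
    (i : A -> B) (f : A -> X) (j : X -> X') (g : B -> X') :
  locally_compact [set: V] -> hausdorff_space V ->
  @is_pushout topological_spaces A B X X' i f j g ->
  forall (Z : topologicalType) (u : X * V -> Z) (v : B * V -> Z),
    continuous u -> continuous v ->
    (forall a t, u (f a, t) = v (i a, t)) ->
    exists w : X' * V -> Z, [/\ continuous w,
      forall x t, w (j x, t) = u (x, t) & forall b t, w (g b, t) = v (b, t)].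
Proof.
move=> lcV hV po Z u v cu cv uv.
have cover := pushout_cover po.
have [[ci cf cj cg] [sq univ]] := po.
have [cu1 cu2] := continuous_curry cu.
have [cv1 cv2] := continuous_curry cv.
have [|w [[cw wj wg] _]] := univ {compact-open, V -> Z} (curry u) (curry v) cu1 cv1.
  by apply/funext => a; apply/funext => t; exact: uv.
exists (uncurry w); split.
- apply: continuous_uncurry => // x'.
  have [[x ->]|[b ->]] := cover x'.
    by rewrite -[w (j x)]/((w \o j) x) wj.
  by rewrite -[w (g b)]/((w \o g) b) wg.
- by move=> x t; rewrite /= -[w (j x)]/((w \o j) x) wj.
- by move=> x t; rewrite /= -[w (g x)]/((w \o g) x) wg.
Qed.

(** The same exponential adjunction for sequential colimits. *)
Lemma colimit_times (V : topologicalType) (S : nat -> topologicalType)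
    (s : forall n, S n -> S n.+1) (X : topologicalType)
    (c : forall n, S n -> X) :
  locally_compact [set: V] -> hausdorff_space V ->
  @is_sequential_colimit topological_spaces S s X c ->
  forall (Z : topologicalType) (u : forall n, S n * V -> Z),
    (forall n, continuous (u n)) ->
    (forall n x t, u n.+1 (s n x, t) = u n (x, t)) ->
    exists w : X * V -> Z, continuous w /\
      forall n x t, w (c n x, t) = u n (x, t).
Proof.
move=> lcV hV co Z u cu us.
have cover := colimit_cover co.
have [_ [_ [_ univ]]] := co.
have [||w [[cw wc] _]] := univ {compact-open, V -> Z} (fun n => curry (u n)).
- by move=> n; exact: (continuous_curry (cu n)).1.
- by move=> n; apply/funext => x; apply/funext => t; exact: us.
exists (uncurry w); split.
  apply: continuous_uncurry => // x; have [n [y ->]] := cover x.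
  rewrite -[w (c n y)]/((w \o c n) y) wc.
  exact: (continuous_curry (cu n)).2.
by move=> n x t; rewrite /= -[w (c n x)]/((w \o c n) x) wc.
Qed.

(** * Forgetting the action of a monoid *)

Section forgetful.
Variable M : monoidType.

Section cofree.
Variable Z : topologicalType.

(** Functions on [M] with the action by right translation form the cofree
    [M]-space on [Z]: equivariant maps into it are plain continuous maps into
    [Z], by evaluation at 1. As [M] is discrete, the compact-open topology is
    the product topology, and currying is available for it. *)
Definition cofree_act (a : M) (h : {compact-open, discrete_topology M -> Z}) :
  {compact-open, discrete_topology M -> Z} := fun b => h (b * a)%g.

Lemma cofree_act1 h : cofree_act 1%g h = h.
Proof. by apply/funext => b; rewrite /cofree_act mulg1. Qed.

Lemma cofree_actM a b h : cofree_act (a * b)%g h = cofree_act a (cofree_act b h).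
Proof. by apply/funext => c; rewrite /cofree_act mulgA. Qed.

Let T : topologicalType := {compact-open, discrete_topology M -> Z}.

Lemma cofree_eval_continuous :
  continuous (fun p : T * discrete_topology M => p.1 p.2).
Proof.
have -> : (fun p : T * discrete_topology M => p.1 p.2) = uncurry (fun p : T => p).
  by apply/funext => -[].
apply: continuous_uncurry; [exact: discrete_locally_compact|exact: discrete_hausdorff|by move=> h; exact: cvg_id|].
by move=> h; exact: discrete_continuous.
Qed.

Lemma cofree_act_continuous :
  continuous (fun p : discrete_topology M * T => cofree_act p.1 p.2 : T).
Proof.
apply: discrete_prod_continuous => a.
have := @continuous_curry T (discrete_topology M) Z
  (fun p => p.1 (p.2 * a)%g).
case=> // p.
have cr : continuous (fun p : T * discrete_topology M =>
    (p.1, (p.2 * a)%g : discrete_topology M)).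
  apply: continuous_pair => q; first exact: cvg_fst.
  apply: (@cvg_comp _ _ _ snd (fun b => (b * a)%g : discrete_topology M)).
    exact: cvg_snd.
  exact: (@discrete_continuous M (discrete_topology M) (fun b => b * a)%g).
exact: (continuous_compose cofree_eval_continuous cr).
Qed.

Definition cofree_mspace : mspace M :=
  @MSpace M T cofree_act cofree_act1 cofree_actM cofree_act_continuous.

Lemma cofree_map (X : mspace M) (u : X -> Z) : continuous u ->
  @mspace_map M X cofree_mspace (fun x a => u (mspace_act a x)).
Proof.
move=> cu; split.
  have := @continuous_curry X (discrete_topology M) Z
    (fun p => u (mspace_act p.2 p.1)).
  case=> //.
  apply: (continuous_compose cu).
  apply: (continuous_compose (@mspace_act_continuous M X)
    (f := fun p : X * discrete_topology M => (p.2, p.1))).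
  by apply: continuous_pair => q; [exact: cvg_snd|exact: cvg_fst].
by move=> a x; apply/funext => b /=; rewrite /cofree_act mspace_actM.
Qed.

Lemma cofree_unmap (X : mspace M) (w : X -> cofree_mspace) :
  mspace_map w -> continuous (fun x => w x 1%g).
Proof.
move=> [cw _].
apply: (continuous_compose cofree_eval_continuous (f := fun x => (w x, 1%g : discrete_topology M))).
apply: continuous_pair => // x; exact: cvg_cst.
Qed.
End cofree.

(** Forgetting the action is left adjoint to the cofree [M]-space, so the
    squares and sequences that are universal among [M]-spaces are universal
    among spaces. Equivariance of the maps built from them can then be checked
    afterwards, on the pieces. *)
Lemma forget_pushout (A B X X' : mspace M) i f j g :
  @is_pushout (mspaces M) A B X X' i f j g ->
  @is_pushout topological_spaces A B X X' i f j g.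
Proof.
move=> [[mi mf mj mg] [sq univ]]; split; first by split; [case: mi|case: mf|case: mj|case: mg].
split=> // Z u v cu cv uv.
have [|w [[mw wj wg] uniq]] := univ (cofree_mspace Z) _ _ (cofree_map cu) (cofree_map cv).
  apply/funext => y; apply/funext => a /=.
  have -> : mspace_act a (f y) = f (mspace_act a y) by case: mf.
  have -> : mspace_act a (i y) = i (mspace_act a y) by case: mi.
  exact: (congr1 (fun h => h (mspace_act a y)) uv).
exists (fun x => w x 1%g); split.
  split; first exact: cofree_unmap.
  - apply/funext => x /=; rewrite -[w (j x)]/((w \o j) x) wj.
    by rewrite mspace_act1.
  - apply/funext => x /=; rewrite -[w (g x)]/((w \o g) x) wg.
    by rewrite mspace_act1.
move=> w' [cw' wj' wg'].
rewrite (uniq (fun x a => w' (mspace_act a x))).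
  by apply/funext => x; rewrite mspace_act1.
split; first exact: cofree_map.
- apply/funext => x; apply/funext => a /=.
  have -> : mspace_act a (j x) = j (mspace_act a x) by case: mj.
  exact: (congr1 (fun h => h (mspace_act a x)) wj').
- apply/funext => x; apply/funext => a /=.
  have -> : mspace_act a (g x) = g (mspace_act a x) by case: mg.
  exact: (congr1 (fun h => h (mspace_act a x)) wg').
Qed.

Lemma forget_colimit (S : nat -> mspace M) s (X : mspace M) c :
  @is_sequential_colimit (mspaces M) S s X c ->
  @is_sequential_colimit topological_spaces S s X c.
Proof.
move=> [ms [mc [sc univ]]]; split; first by move=> n; case: (ms n).
split; first by move=> n; case: (mc n).
split=> // Z u cu su.
have [||w [[mw wc] uniq]] := univ (cofree_mspace Z) (fun n x a => u n (mspace_act a x)).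
- by move=> n; exact: (cofree_map (cu n)).
- move=> n; apply/funext => x; apply/funext => a /=.
  have -> : mspace_act a (s n x) = s n (mspace_act a x) by case: (ms n).
  exact: (congr1 (fun h => h (mspace_act a x)) (su n)).
exists (fun x => w x 1%g); split.
  split; first exact: cofree_unmap.
  move=> n; apply/funext => x /=; rewrite -[w (c n x)]/((w \o c n) x) wc.
  by rewrite mspace_act1.
move=> w' [cw' wc'].
rewrite (uniq (fun x a => w' (mspace_act a x))).
  by apply/funext => x; rewrite mspace_act1.
split; first exact: cofree_map.
move=> n; apply/funext => x; apply/funext => a /=.
have -> : mspace_act a (c n x) = c n (mspace_act a x) by case: (mc n).
exact: (congr1 (fun h => h (mspace_act a x)) (wc' n)).
Qed.

End forgetful.

(** * Skeleta of a CW complex and compact spaces *)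

(** The induction on [N] shifts the sequence by one, so that a stage [S n] with
    [n < N] never has to be compared with [S N] through an explicit composite of
    steps: at the last moment the missing stage 0 is filled by composition. *)
Lemma seq_extend (Z : Type) (S : nat -> Type) (s : forall n, S n -> S n.+1)
    (good : forall n, (S n -> Z) -> Prop) :
  (forall n u, good n.+1 u -> good n (u \o s n)) ->
  (forall n u, good n u -> exists2 u', good n.+1 u' & u' \o s n = u) ->
  forall N u, good N u -> exists U : forall n, S n -> Z,
    [/\ U N = u, forall n, good n (U n) & forall n, U n.+1 \o s n = U n].
Proof.
move=> down up N; elim: N S s good down up => [|N IH] S s good down up u gu.
  pose next n (v : {v | good n v}) : {v | good n.+1 v} :=
    let w := cid2 (up n _ (svalP v)) in exist _ (s2val w) (s2valP w).
  pose U := fix U n : {v | good n v} :=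
    if n is m.+1 then next m (U m) else exist _ u gu.
  exists (fun n => sval (U n)); split => // n; first exact: (svalP (U n)).
  exact: (s2valP' (cid2 (up n _ (svalP (U n))))).
have [U [UN gU sU]] := IH (fun n => S n.+1) (fun n => s n.+1)
  (fun n => good n.+1) (fun n => down n.+1) (fun n => up n.+1) u gu.
exists (fun n => if n is m.+1 then U m else U 0%N \o s 0%N); split => //.
  by case=> [|n]; [exact: down|exact: gU].
by case=> [|n].
Qed.

Section cells.
Variable R : realType.

Lemma sumsq_continuous n : continuous (fun x : 'rV[R]_n => \sum_(i < n) x 0 i ^+ 2).
Proof.
apply: continuous_big; first exact: add_continuous.
move=> i _; apply: (continuous_compose (@exprn_continuous R 2)).
exact: coord_continuous.
Qed.

Definition ball_bdry n (b : Ball R n) (Sb : sphere_set (sval b)) : Sphere R n :=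
  exist _ (sval b) (mem_set Sb).

Lemma cell_incl_bdry (P : Type) n (p : P * Ball R n) (Sp : sphere_set (sval p.2)) :
  cell_incl (p.1, ball_bdry Sp) = p.
Proof. by case: p Sp => d b Sb; congr pair; exact: eq_sig_hprop. Qed.

Lemma cell_incl_sphere (P : Type) n (p : P * Sphere R n) :
  sphere_set (sval (cell_incl p).2).
Proof. exact: set_mem (svalP p.2). Qed.

Lemma cell_incl_inj (P : Type) n : injective (@cell_incl R P n).
Proof.
move=> [d s] [e t] [-> st]; congr pair.
by apply: eq_sig_hprop => //= x; exact: Prop_irrelevance.
Qed.

Lemma cell_incl_closed (P : choiceType) n
    (C : set (discrete_topology P * Sphere R n)) :
  closed C -> closed ((@cell_incl R P n) @` C : set (discrete_topology P * Ball R n)).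
Proof.
move=> clC; apply: discrete_prod_closed => d.
have /continuous_closedP/(_ C clC) :
    continuous (fun x : Sphere R n => (d : discrete_topology P, x)).
  apply: (@continuous_pair (Sphere R n) (discrete_topology P) (Sphere R n)
    (fun=> d : discrete_topology P) idfun).
    exact: cst_continuous.
  exact: continuous_idfun.
rewrite -openC => -[F oF FC].
have clS : closed (@sphere_set R n).
  apply: (closed_comp (f := fun x : 'rV[R]_n => \sum_(i < n) x 0 i ^+ 2)
    (D := [set 1])).
    by move=> x _; exact: sumsq_continuous.
  exact: closed_eq.
rewrite -openC; exists (F `|` ~` @sphere_set R n).
  by apply: openU => //; rewrite openC.
apply/seteqP; split => [b /= Fb [[e x] Cex [ed xb]]|b /= nC].
  have bx : set_val b = set_val x by rewrite -xb.
  case: Fb; rewrite bx.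
    by move=> Fx; have : (~` [set x | C (d, x)]) x; [rewrite -FC|rewrite /= -ed].
  by apply; exact: set_mem (svalP x).
have [Sb|] := pselect (sphere_set (sval b)); last by right.
left; have : (~` [set x | C (d, x)]) (ball_bdry Sb).
  move=> /= Cx; apply: nC; exists (d, ball_bdry Sb) => //=.
  exact: (cell_incl_bdry (p := (d, b)) Sb).
by rewrite -FC.
Qed.

End cells.

(** [T] with a generic point [None] added: every nonempty open set contains
    it. All points of a CW complex outside a given skeleton can be sent to
    [None] continuously, because the skeleton is closed. *)
Definition generic_option (T : Type) : Type := option T.

Section generic_option.
Variable T : topologicalType.

HB.instance Definition _ := Choice.copy (generic_option T) (option T).

Definition generic_open : set_system (generic_option T) :=
  [set O | open (Some @^-1` O : set T) /\ forall z, O z -> O None].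

Lemma generic_openT : generic_open setT.
Proof. by split => //; exact: openT. Qed.

Lemma generic_openI : setI_closed generic_open.
Proof.
move=> A B [oA gA] [oB gB]; split; first exact: openI.
by move=> z [Az Bz]; split; [exact: gA Az|exact: gB Bz].
Qed.

Lemma generic_open_bigU (I : Type) (F : I -> set (generic_option T)) :
  (forall i, generic_open (F i)) -> generic_open (\bigcup_i F i).
Proof.
move=> oF; split.
  by rewrite preimage_bigcup; apply: bigcup_open => i _; case: (oF i).
by move=> z [i _ Fz]; exists i => //; case: (oF i) => _; apply; exact: Fz.
Qed.

HB.instance Definition _ := isOpenTopological.Build (generic_option T)
  generic_openT generic_openI generic_open_bigU.

Lemma generic_Some_continuous : continuous (Some : T -> generic_option T).
Proof. by apply/continuousP => A []. Qed.

End generic_option.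

(** Natural numbers whose open sets are the initial segments: a continuous map
    to this space is an upper semicontinuous function, and it is bounded on
    compact spaces. *)
Definition lower_nat : Type := nat.
HB.instance Definition _ := Choice.copy lower_nat nat.

Section lower_nat.

Definition lower_open : set_system lower_nat :=
  [set O | forall m n : nat, (m <= n)%N -> O n -> O m].

Lemma lower_openT : lower_open setT. Proof. by []. Qed.

Lemma lower_openI : setI_closed lower_open.
Proof. by move=> A B oA oB m n mn [/(oA _ _ mn) ? /(oB _ _ mn)]. Qed.

Lemma lower_open_bigU (I : Type) (F : I -> set lower_nat) :
  (forall i, lower_open (F i)) -> lower_open (\bigcup_i F i).
Proof. by move=> oF m n mn [i _ Fz]; exists i => //; exact: oF mn Fz. Qed.

HB.instance Definition _ := isOpenTopological.Build lower_nat
  lower_openT lower_openI lower_open_bigU.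

End lower_nat.

Section cw.
Variables (R : realType) (Y : topologicalType) (K : cw_complex R Y).

Local Notation skel := (cw_skel_space K).
Local Notation incl n := (@cw_incl R Y K n).

Lemma cw_incl_step n y : incl n.+1 (cw_step y) = incl n y.
Proof.
have [_ [_ [st _]]] := cw_colimit K.
by rewrite -[incl n]st.
Qed.

Lemma cw_incl_continuous n : continuous (incl n).
Proof. by have [_ [ci _]] := cw_colimit K; exact: ci. Qed.

Lemma cw_step_continuous n : continuous (@cw_step R Y K n).
Proof. by have [cs _] := cw_colimit K; exact: cs. Qed.

Lemma cw_attach_step n p :
  cw_step (cw_attach p) = cw_char (cell_incl p) :> skel n.+1.
Proof.
have [_ [sq _]] := @cw_pushout _ _ K n.
exact: (congr1 (fun h => h p) sq).
Qed.

Lemma cw_skeleton_mono m n : (m <= n)%N -> cw_skeleton K m `<=` cw_skeleton K n.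
Proof.
move=> /subnK <-; elim: (n - m)%N => // k IH y /IH[x _ <-].
by exists (cw_step x) => //; exact: cw_incl_step.
Qed.

Lemma cw_skeleton_cover y : exists n, cw_skeleton K n y.
Proof. by have [n [x ->]] := colimit_cover (cw_colimit K) y; exists n, x. Qed.

(** A map defined on a skeleton is extended over the open cells by arbitrary
    values [c]. For a Hausdorff target this would rarely be continuous; the two
    targets used below have so few open sets that the condition on [c] is easy
    to meet. *)
Lemma cell_extend n (Z : topologicalType) (u : skel n -> Z)
    (c : cw_cells K n.+1 * Ball R n.+1 -> Z) :
  continuous u ->
  (forall F, closed F -> F = setT \/ closed
     [set p : discrete_topology (cw_cells K n.+1) * Ball R n.+1 |
      F (c p) /\ ~ sphere_set (sval p.2)]) ->
  exists u' : skel n.+1 -> Z, [/\ continuous u', u' \o @cw_step R Y K n = u &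
    forall p, ~ sphere_set (sval p.2) -> u' (cw_char p) = c p].
Proof.
move=> cu clc.
have [[_ ca _ _] [_ univ]] := @cw_pushout _ _ K n.
pose v (p : discrete_topology (cw_cells K n.+1) * Ball R n.+1) : Z :=
  match pselect (sphere_set (sval p.2)) with
  | left Sp => u (cw_attach (p.1, ball_bdry Sp))
  | right _ => c p
  end.
have vS p : v (cell_incl p) = u (cw_attach p).
  rewrite /v; case: pselect => [Sp|]; last by case; exact: cell_incl_sphere.
  by do 2 congr (_ _); apply: cell_incl_inj; rewrite cell_incl_bdry.
have [||/=|u' [[cu' u's u'c] _]] := univ Z u v => //.
- apply/continuous_closedP => F clF.
  have [->|clcF] := clc F clF; first exact: closedT.
  rewrite (_ : _ @^-1` _ = ((@cell_incl R _ n.+1) @` [set p | F (u (cw_attach p))])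
     `|` [set p | F (c p) /\ ~ sphere_set (sval p.2)]).
    apply: closedU; last exact: clcF.
    apply: cell_incl_closed.
    by apply: (closed_comp (f := u \o @cw_attach R Y K n)) => // p _;
       apply: (continuous_compose cu).
  apply/seteqP; split => p /=.
    rewrite /v; case: pselect => Sp Fp; last by right.
    by left; exists (p.1, ball_bdry Sp) => //; exact: cell_incl_bdry.
  case=> [[q Fq <-]|[Fp Sp]]; first by rewrite vS.
  by rewrite /v; case: pselect.
- by apply/funext => p; rewrite /= vS.
exists u'; split=> // p Sp.
by rewrite -[u' _]/((u' \o @cw_char _ _ K n) p) u'c /v; case: pselect.
Qed.

(** Sending the cells of dimension above [N] to the generic point undoes the
    inclusion of the [N]-skeleton. Hence this inclusion is injective, and an
    embedding. *)
Lemma cw_generic_retract N : exists w : Y -> generic_option (skel N),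
  continuous w /\ forall y, w (incl N y) = Some y.
Proof.
have [|||U [UN cU sU]] := @seq_extend (generic_option (skel N)) skel (@cw_step R Y K)
  (fun n (u : skel n -> generic_option (skel N)) => continuous u) _ _ N Some.
- by move=> n u cu; apply: continuous_compose => //; exact: cw_step_continuous.
- move=> n u cu.
  have [F clF|u' [cu' su' _]] := @cell_extend n _ u (fun=> None) cu; last by exists u'.
  (* A closed set that contains the generic point is everything. *)
  have [FN|FN] := pselect (F None); [left|right].
    rewrite -subTset => z _; apply: contrapT => nF.
    by move: clF; rewrite -openC => -[_ /(_ z nF)].
  rewrite (_ : [set _ | _] = set0); first exact: closed0.
  by rewrite -subset0 => p [].
- exact: generic_Some_continuous.
have [_ [_ [_ univ]]] := cw_colimit K.
have [//|//|w [[cw wc] _]] := univ _ U.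
exists w; split=> // y.
by rewrite -[w _]/((w \o incl N) y) wc UN.
Qed.

Lemma cw_incl_inj n : injective (incl n).
Proof.
have [w [_ wS]] := cw_generic_retract n.
by move=> x y /(congr1 w); rewrite !wS => -[].
Qed.

(** An open subset [A] of the skeleton is the trace of an open subset of [Y],
    namely the preimage of [A] and the generic point together. *)
Lemma cw_lift (C : topologicalType) (phi : C -> Y) N :
  continuous phi -> (forall x, cw_skeleton K N (phi x)) ->
  exists2 psi : C -> skel N, continuous psi & forall x, incl N (psi x) = phi x.
Proof.
move=> cphi /(_ _)/cid2-/all_sig2[psi _ psiE].
exists psi => //.
have [w [cw wS]] := cw_generic_retract N.
apply/continuousP => A oA.
have /continuousP/(_ ((Some @` A) `|` [set None])) := continuous_compose cw cphi.
have -> : (w \o phi) @^-1` ((Some @` A) `|` [set None]) = psi @^-1` A.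
  apply/seteqP; split=> x /=; rewrite -psiE wS.
    by case=> // -[a Aa [<-]].
  by move=> Ax; left; exists (psi x).
apply; split=> /=; last by right.
rewrite (_ : _ @^-1` _ = A) //; apply/seteqP; split => x /=.
  by case=> // -[a Aa [<-]].
by move=> Ax; left; exists x.
Qed.

(** Otherwise there are points [x i] with [phi (x i)] outside the [i]-skeleton.
    An upper semicontinuous function on [Y] whose value at [phi (x i)] is at
    least [i] is built skeleton by skeleton: the points [phi (x i)] that appear
    for the first time in the [(n+1)]-skeleton have [i <= n], so they are
    finitely many and the value [n] is large enough for them. Its composite with
    [phi] is unbounded on a compact space. *)
Lemma cw_compact_skeleton (C : topologicalType) (phi : C -> Y) :
  compact [set: C] -> continuous phi ->
  exists N, forall x, cw_skeleton K N (phi x).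
Proof.
move=> cptC cphi; apply: contrapT => /forallNP/= noN.
have /(_ _)/cid-/all_sig[x xN] : forall N, exists x, ~ cw_skeleton K N (phi x).
  by move=> N; apply/existsNP.
pose good n (u : skel n -> lower_nat) := continuous u /\
  forall i y, incl n y = phi (x i) -> (i <= u y)%N.
have [|||U [_ gU sU]] := @seq_extend lower_nat skel (@cw_step R Y K) good
    _ _ 0%N (fun=> 0%N).
- move=> n u [cu ux]; split.
    by apply: continuous_compose => //; exact: cw_step_continuous.
  by move=> i y yx; apply: ux; rewrite cw_incl_step.
- move=> n u [cu ux].
  pose rep (p : cw_cells K n.+1 * Ball R n.+1) (i : 'I_n.+1) :=
    incl n.+1 (cw_char (p : discrete_topology _ * _)) = phi (x i).
  (* One chosen cell point for each [phi (x i)] that has one, with [i <= n]. *)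
  pose E : set (discrete_topology (cw_cells K n.+1) * Ball R n.+1) :=
    [set p | exists i, exists h : exists p, rep p i, p = sval (cid h)].
  have finE : finite_set E.
    apply: (@sub_finite_set _ _ (\bigcup_(i in [set: 'I_n.+1])
      [set p | exists h : exists p, rep p i, p = sval (cid h)])).
      by move=> p [i [h ->]]; exists i => //; exists h.
    apply: bigcup_finite; first exact: finite_finset.
    move=> i _; have [h|h] := pselect (exists p, rep p i).
      apply: (@sub_finite_set _ _ [set sval (cid h)]); last exact: finite_set1.
      by move=> p [h' ->] /=; congr (sval (cid _)); exact: Prop_irrelevance.
    by rewrite (_ : [set _ | _] = set0) // -subset0 => p [].
  have [F clF|u' [cu' su' u'c]] := @cell_extend n _ u
      (fun p => if `[< E p >] then n else 0%N) cu.
    have [F0|F0] := pselect (F 0%N); [left|right].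
      rewrite -subTset => z _; apply: contrapT => nF.
      by move: clF; rewrite -openC => /(_ 0%N z (leq0n z) nF); exact.
    have acc : accessible_space
        (discrete_topology (cw_cells K n.+1) * Ball R n.+1)%type.
      apply: hausdorff_accessible; apply: hausdorff_prod.
        exact: discrete_hausdorff.
      by apply: set_type_hausdorff; exact: norm_hausdorff.
    apply: (accessible_finite_set_closed.1 acc).
    by apply: sub_finite_set finE => p []; case: asboolP.
  exists u' => //; split => // i y yx.
  have [[z yz]|[p yp]] := pushout_cover (@cw_pushout _ _ K n) y.
    rewrite yz -[u' _]/((u' \o @cw_step _ _ _ _) z) su'; apply: ux.
    by rewrite -cw_incl_step -yz.
  have [skn|nskn] := pselect (cw_skeleton K n (phi (x i))).
    have [z _ zx] := skn.
    have -> : y = cw_step z by apply: (@cw_incl_inj n.+1); rewrite yx cw_incl_step.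
    by rewrite -[u' _]/((u' \o @cw_step _ _ _ _) z) su'; exact: ux.
  have lein : (i < n.+1)%N.
    rewrite ltnNge; apply/negP => ni; apply: (xN i).
    by apply: (cw_skeleton_mono ni); exists y.
  have h : exists p, rep p (Ordinal lein) by exists p; rewrite /rep -yp.
  have Eh : E (sval (cid h)) by exists (Ordinal lein), h.
  have yh : y = cw_char (sval (cid h) : discrete_topology _ * _).
    by apply: (@cw_incl_inj n.+1); rewrite yx; exact: (esym (svalP (cid h))).
  rewrite yh u'c.
    by rewrite asboolT.
  move=> Sh; apply: nskn.
  exists (cw_attach ((sval (cid h)).1 : discrete_topology _, ball_bdry Sh)) => //.
  rewrite -cw_incl_step cw_attach_step -yx yh; congr (incl _ (cw_char _)).
  exact: cell_incl_bdry.
- split; first exact: cst_continuous.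
  move=> i y yx; case: (xN i); apply: (cw_skeleton_mono (leq0n i)).
  by exists y.
have [_ [_ [_ univ]]] := cw_colimit K.
have [||w [[cw wc] _]] := univ _ U; [by move=> n; case: (gU n)|by []|].
have wx i : (i <= w (phi (x i)))%N.
  have [n [y _ yx]] := cw_skeleton_cover (phi (x i)).
  rewrite -yx -[w _]/((w \o incl n) y) wc.
  by case: (gU n) => _; apply.
move/compact_near_coveringP : cptC.
move=> /(_ nat \oo (fun j c => (w (phi c) < j)%N)).
case.
  move=> c _; exists ([set c' | (w (phi c') <= w (phi c))%N], [set j | (w (phi c) < j)%N]).
    split => /=; last by exists (w (phi c)).+1.
    have := continuous_compose cw cphi.
    move=> /continuousP/(_ [set m | (m <= w (phi c))%N]) oc.
    apply: open_nbhs_nbhs; split; last exact: leqnn.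
    by apply: oc; suff : lower_open [set m | (m <= w (phi c))%N] by [];
       move=> m m' mm'; exact: leq_trans.
  by move=> [c' j] [/= h1 h2]; exact: leq_ltn_trans h2.
move=> j _ /(_ j (leqnn j) (x j) I).
by rewrite ltnNge wx.
Qed.

End cw.

(** * Maps from low to high dimension miss a point *)

Section continuous_algebra.
Variables (R : realType) (T : topologicalType) (V : normedModType R).

Lemma cont_add (f g : T -> V) :
  continuous f -> continuous g -> continuous (fun x => f x + g x).
Proof. by move=> cf cg x; exact: (continuousD (cf x) (cg x)). Qed.

Lemma cont_sub (f g : T -> V) :
  continuous f -> continuous g -> continuous (fun x => f x - g x).
Proof. by move=> cf cg x; exact: (continuousB (cf x) (cg x)). Qed.

Lemma cont_scale (f : T -> R) (g : T -> V) :
  continuous f -> continuous g -> continuous (fun x => f x *: g x).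
Proof. by move=> cf cg x; apply: (@cvgZ R V); [exact: cf|exact: cg]. Qed.

Lemma cont_norm (g : T -> V) : continuous g -> continuous (fun x => `|g x|).
Proof. by move=> cg; apply: (continuous_compose (@norm_continuous R V)). Qed.

Lemma cont_mul (f g : T -> R) :
  continuous f -> continuous g -> continuous (fun x => f x * g x).
Proof. by move=> cf cg x; apply: (@cvgM R); [exact: cf|exact: cg]. Qed.

Lemma cont_inv (f : T -> R) : (forall x, f x != 0) ->
  continuous f -> continuous (fun x => (f x)^-1).
Proof. by move=> f0 cf x; apply: (@cvgV R) => //; exact: cf. Qed.

Lemma cont_min (f g : T -> R) :
  continuous f -> continuous g -> continuous (fun x => Num.min (f x) (g x)).
Proof. by move=> cf cg x; exact: (continuous_min (cf x) (cg x)). Qed.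

Lemma cont_max (f g : T -> R) :
  continuous f -> continuous g -> continuous (fun x => Num.max (f x) (g x)).
Proof. by move=> cf cg x; exact: (continuous_max (cf x) (cg x)). Qed.

Lemma near_lt (f : T -> R) c x : continuous f -> f x < c ->
  \forall y \near x, f y < c.
Proof. by move=> cf; apply: cvgr_lt; exact: cf. Qed.

Lemma near_gt (f : T -> R) c x : continuous f -> c < f x ->
  \forall y \near x, c < f y.
Proof. by move=> cf; apply: cvgr_gt; exact: cf. Qed.

End continuous_algebra.

Section supnorm.
Variables (R : realType) (n : nat).
Implicit Types x y : 'rV[R]_n.

Lemma rV_norm_le x (e : R) : 0 <= e -> (`|x| <= e) <-> (forall i, `|x 0 i| <= e).
Proof.
move=> e0; have -> : `|x| = \big[Num.max/0]_ij `|x ij.1 ij.2| := mx_normrE x.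
split.
  by move=> /bigmax_leP[_ h] i; exact: (h (0, i)).
by move=> h; apply/bigmax_leP; split => // -[i j] _ /=; rewrite ord1.
Qed.

Lemma rV_coord_le x i : `|x 0 i| <= `|x|.
Proof. by move: i; apply/rV_norm_le. Qed.

Lemma rV_continuous (T : topologicalType) (f : T -> 'rV[R]_n) :
  (forall i, continuous (fun t => f t 0 i)) -> continuous f.
Proof.
move=> cf t; apply/(@cvgrPdist_le R 'rV[R]_n) => e e0.
have : \forall t' \near t, forall i, (i \in [set: 'I_n]) ->
    `|f t 0 i - f t' 0 i| <= e.
  apply: filter_forall => i.
  have /(@cvgrPdist_le R R)/(_ e e0) := cf i t.
  by apply: filterS => t' h _.
apply: filterS => t' h; apply/rV_norm_le; first exact: ltW.
by move=> i; rewrite !mxE; apply: h; rewrite inE.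
Qed.

End supnorm.

Section lipschitz.
Variables (R : realType) (D : topologicalType) (k : nat) (j : D -> 'rV[R]_k).
Hypothesis cptD : compact [set: D].
Hypothesis cj : continuous j.
Hypothesis ij : injective j.

Lemma compact_bounded_fun (v : D -> R) : continuous v ->
  exists B, forall x, `|v x| < B.
Proof.
move=> cv; move/compact_near_coveringP : cptD.
move=> /(_ R +oo (fun B x => `|v x| < B)) [].
  move=> x _; exists ([set y | `|v y| < `|v x| + 1], [set B | `|v x| + 1 < B]).
    split => /=; last by apply: nbhs_pinfty_gt; exact: num_real.
    by apply: (near_lt (cont_norm (V := R^o) cv)); rewrite ltrDl.
  by move=> [y B] [/= h1 h2]; exact: lt_trans h2.
move=> B [_ h]; exists (B + 1) => x; apply: h => //.
by rewrite ltrDl.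
Qed.

(** On a compact space, distances measured through a continuous injection [j]
    into a Euclidean space are as good as an intrinsic metric. *)
Lemma unif_cont (v : D -> R) (d : R) : continuous v -> 0 < d ->
  exists2 e, 0 < e & forall x y, `|j x - j y| < e -> `|v x - v y| < d.
Proof.
move=> cv d0; have /compact_near_coveringP := compact_prod cptD cptD.
have c1 (Z : topologicalType) (f : D -> Z) : continuous f -> continuous (fun p : D * D => f p.1).
  by move=> cf; apply: (continuous_compose cf) => p; exact: cvg_fst.
have c2 (Z : topologicalType) (f : D -> Z) : continuous f -> continuous (fun p : D * D => f p.2).
  by move=> cf; apply: (continuous_compose cf) => p; exact: cvg_snd.
have cvv : continuous (fun p : D * D => `|v p.1 - v p.2|).
  by apply: (@cont_norm R _ R^o); apply: (@cont_sub R _ R^o); [exact: c1|exact: c2].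
have cjj : continuous (fun p : D * D => `|j p.1 - j p.2|).
  by apply: (@cont_norm R _ 'rV[R]_k); apply: cont_sub; [exact: c1|exact: c2].
move=> /(_ R 0^'+ (fun e p => `|v p.1 - v p.2| < d \/ e < `|j p.1 - j p.2|)) [].
  move=> p _; have [vd|dv] := ltP `|v p.1 - v p.2| d.
    exists ([set q | `|v q.1 - v q.2| < d], setT).
      split => /=; last exact: filterT.
      exact: (near_lt cvv vd).
    by move=> [q e] [/= h _]; left.
  have r0 : 0 < `|j p.1 - j p.2|.
    rewrite normr_gt0 subr_eq0; apply/eqP => /ij pp.
    by move: dv; rewrite pp subrr normr0 leNgt d0.
  exists ([set q | `|j p.1 - j p.2| / 2 < `|j q.1 - j q.2|],
          [set e | e < `|j p.1 - j p.2| / 2]).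
    split => /=.
      by apply: (near_gt cjj); rewrite ltr_pdivrMr // ltr_pMr // ltr1n.
    by apply: nbhs_right_lt; rewrite divr_gt0.
  by move=> [q e] [/= h1 h2]; right; exact: lt_trans h2 h1.
move=> e /= e0 h; exists (e / 2); first by rewrite divr_gt0.
have hp : 0 < e / 2 by rewrite divr_gt0.
have hb : ball_ (fun t : R => `|t|) 0 e (e / 2).
  by rewrite /ball_ /= sub0r normrN gtr0_norm // ltr_pdivrMr // ltr_pMr // ltr1n.
move=> x y xy; case: (h _ hb hp (x, y) I) => //= /(lt_trans xy).
by rewrite ltxx.
Qed.

(** The infimal convolution [w x = inf_y (v y + L |j x - j y|)] is
    [L]-Lipschitz by construction. It never exceeds [v], and for large [L] the
    infimum is approached only at points [y] near [x], where [v y] is close to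
    [v x]. *)
Lemma lipschitz_approx1 (v : D -> R) (d : R) : continuous v -> 0 < d ->
  exists L w, [/\ 0 <= L, forall x, `|w x - v x| <= d &
    forall x y, `|w x - w y| <= L * `|j x - j y|].
Proof.
move=> cv d0; have [e e0 ve] := unif_cont cv d0.
have [B vB] := compact_bounded_fun cv.
(* Beyond distance [e], the penalty is at least [2 * B], which bounds the
   oscillation of [v]. *)
pose L := Num.max 0 (2 * B / e).
have L0 : 0 <= L by rewrite le_max lexx.
pose S x := [set v y + L * `|j x - j y| | y in [set: D]].
pose w x := inf (S x).
have Slb x : lbound (S x) (- B).
  move=> _ [y _ <-]; rewrite -[- B]addr0 lerD ?mulr_ge0 //.
  by have := vB y; rewrite ltr_norml => /andP[/ltW].
have Sne x : S x !=set0 by exists (v x + L * `|j x - j x|); exists x.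
have hS x : has_lbound (S x) by exists (- B).
exists L, w; split=> //.
  move=> x; rewrite distrC ler_norml; apply/andP; split.
    have : w x <= v x + L * `|j x - j x| by apply: ge_inf => //; exists x.
    rewrite subrr normr0 mulr0; lra.
  rewrite lerBlDr -lerBlDl; apply: lb_le_inf => // _ [y _ <-].
  have [xy|xy] := ltP `|j x - j y| e.
    have := ve _ _ xy; rewrite ltr_norml => /andP[_ /ltW vxy].
    have : 0 <= L * `|j x - j y| by rewrite mulr_ge0.
    lra.
  have : 2 * B <= L * `|j x - j y|.
    apply: (@le_trans _ _ (L * e)); last by rewrite ler_wpM2l.
    by rewrite -ler_pdivrMr // le_max lexx orbT.
  have := vB y; have := vB x; rewrite !ltr_norml => /andP[_ +] /andP[+ _].
  lra.
have one x y : w x - w y <= L * `|j x - j y|.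
  rewrite lerBlDl -lerBlDr; apply: lb_le_inf => // _ [z _ <-].
  rewrite lerBlDr; apply: (@le_trans _ _ (v z + L * `|j x - j z|)).
    by apply: ge_inf => //; exists z.
  rewrite -addrA lerD2l -mulrDr ler_wpM2l //.
  have -> : j x - j z = (j y - j z) + (j x - j y) by rewrite [RHS]addrC addrA subrK.
  exact: ler_normD.
move=> x y; rewrite ler_norml one andbT lerNl opprB distrC; exact: one.
Qed.

Lemma lipschitz_approx m (v : D -> 'rV[R]_m) (d : R) : continuous v -> 0 < d ->
  exists L w, [/\ 0 < L, forall x, `|w x - v x| <= d &
    forall x y, `|w x - w y| <= L * `|j x - j y|].
Proof.
move=> cv d0.
have cvi i : continuous (fun x => v x 0 i).
  by apply: (continuous_compose (@coord_continuous R 1 m 0 i)).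
have /(_ _)/cid-/all_sig[L Lw] i := lipschitz_approx1 (cvi i) d0.
have /(_ _)/cid-/all_sig[w wP] := Lw.
pose L' := 1 + \sum_i L i.
have LL' i : L i <= L'.
  rewrite /L' (bigD1 i) //= addrCA lerDl addr_ge0 // sumr_ge0 // => l _.
  by case: (wP l).
have L'0 : 0 < L' by rewrite /L' ltr_pwDl // sumr_ge0 // => l _; case: (wP l).
exists L', (fun x => \row_i w i x); split => // [x|x y].
  apply/rV_norm_le; first exact: ltW.
  by move=> i; rewrite !mxE; case: (wP i).
apply/rV_norm_le; first by rewrite mulr_ge0 // ltW.
move=> i; rewrite !mxE; case: (wP i) => _ _ /(_ x y) /le_trans; apply.
by rewrite ler_wpM2r.
Qed.

Lemma lipschitz_continuous m (w : D -> 'rV[R]_m) (L : R) : 0 < L ->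
  (forall x y, `|w x - w y| <= L * `|j x - j y|) -> continuous w.
Proof.
move=> L0 lw x; apply/(@cvgrPdist_lt R 'rV[R]_m) => e e0.
have jx := @cj x; move/(@cvgrPdist_lt R 'rV[R]_k)/(_ (e / L)) : jx.
rewrite divr_gt0 // => /(_ isT); apply: filterS => y xy.
by apply: le_lt_trans (lw x y) _; rewrite mulrC -ltr_pdivlMr.
Qed.

End lipschitz.

Section missing_point.
Variables (R : realType) (D : topologicalType) (k m : nat) (j : D -> 'rV[R]_k).
Hypothesis cptD : compact [set: D].
Hypothesis cj : continuous j.
Hypothesis ij : injective j.
Hypothesis km : (k < m)%N.

(** Pigeonhole. Cut a cube that contains the image of [j] into [N ^ k] small
    cubes, and consider [K ^ m] grid points with [N] a fixed multiple of [K]. As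
    [k < m], for large [K] there are more grid points than small cubes. If every
    grid point were close to a value of [w], then two of these values would
    come from the same small cube, and a Lipschitz map cannot spread them
    as far apart as two grid points are. *)
Lemma lipschitz_misses (w : D -> 'rV[R]_m) (L r : R) : 0 < L -> 0 < r ->
  (forall x y, `|w x - w y| <= L * `|j x - j y|) ->
  exists (q : 'rV[R]_m) (e : R), [/\ 0 < e, forall i, 0 <= q 0 i <= r & forall x, e <= `|w x - q|].
Proof.
move=> L0 r0 lw.
have [B jB] : exists B, 0 < B /\ forall x i, - B < j x 0 i < B.
  have [B jB] := compact_bounded_fun cptD (cont_norm cj).
  exists (Num.max 1 B); split => [|x i]; first by rewrite lt_max ltr01.
  rewrite -ltr_norml lt_max; apply/orP; right.
  by apply: le_lt_trans (rV_coord_le _ _) _; have := jB x; rewrite normr_id.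
have {jB}[B0 jB] := jB.
have [c cP] : exists c : nat, L * (2 * B) * 4 / r <= c%:R /\ (0 < c)%N.
  exists (Num.truncn (L * (2 * B) * 4 / r)).+1; split => //.
  by rewrite ltW // truncnS_gt.
have {cP}[cP c0] := cP.
(* [N ^ k = c ^ k * K ^ k < K ^ k.+1], and the small cubes have side at most
   a fraction of [s] that is absorbed by the Lipschitz constant [L]. *)
pose K := (c ^ k).+1; pose N := (c * K)%N.
have K0 : 0 < K%:R :> R by rewrite ltr0n.
have N0 : 0 < N%:R :> R by rewrite ltr0n muln_gt0 c0.
pose s : R := r / K%:R.
have s0 : 0 < s by rewrite divr_gt0.
pose grid (z : {ffun 'I_m -> 'I_K}) : 'rV[R]_m := \row_i ((z i)%:R * s).
have gridr z i : 0 <= grid z 0 i <= r.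
  rewrite mxE; apply/andP; split; first by rewrite mulr_ge0 // ltW.
  rewrite /s mulrA ler_pdivrMr // mulrC ler_wpM2l ?(ltW r0) //.
  by rewrite ler_nat ltnW.
apply: contrapT => noq.
have /(_ _)/cid-/all_sig[x xP] : forall z, exists x, `|w x - grid z| < s / 4.
  move=> z; apply: contrapT => /forallNP nx; apply: noq.
  exists (grid z), (s / 4); split => // [|x]; first by rewrite divr_gt0.
  by rewrite leNgt; apply/negP; exact: nx.
pose f x i : R := (j x 0 i + B) / (2 * B) * N%:R.
have f0 x' i : 0 <= f x' i.
  have /andP[h _] := jB x' i.
  by rewrite /f mulr_ge0 // divr_ge0 //; lra.
have fN x' i : f x' i < N%:R.
  have /andP[_ h] := jB x' i.
  by rewrite /f gtr_pMl // ltr_pdivrMr ?mul1r; lra.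
have idxP x' i : (Num.truncn (f x' i) < N)%N.
  by rewrite truncn_lt_nat.
pose idx z : {ffun 'I_k -> 'I_N} := [ffun i => Ordinal (idxP (x z) i)].
have : ~ injective idx.
  move=> /leq_card; rewrite !card_ffun !card_ord; apply/negP; rewrite -ltnNge.
  rewrite /N expnMn; apply: (@leq_trans (K ^ k.+1)); last by rewrite leq_pexp2l.
  by rewrite expnS ltn_mul2r expn_gt0 /K ltnSn.
apply => z z' /ffunP zz'; apply/ffunP => i; apply: contrapT => zi.
have jxx : `|j (x z) - j (x z')| <= 2 * B / N%:R.
  apply/rV_norm_le; first by rewrite divr_ge0 // mulr_ge0 // ltW.
  move=> l; have := congr1 val (zz' l); rewrite !ffunE /= => tt'.
  have ff : `|f (x z) l - f (x z') l| <= 1.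
    have := truncn_itv (f0 (x z) l); have := truncn_itv (f0 (x z') l).
    rewrite tt' -!natr1 => /andP[h1 h2] /andP[h3 h4].
    by rewrite ler_norml; apply/andP; split; lra.
  move: ff; rewrite (_ : _ - _ = (j (x z) 0 l - j (x z') 0 l) * (N%:R / (2 * B))).
    rewrite normrM [X in _ * X]gtr0_norm ?divr_gt0 // ?mulr_gt0 //.
    by rewrite -ler_pdivlMr ?divr_gt0 ?mulr_gt0 // invf_div mul1r !mxE.
  by rewrite /f; field; rewrite gt_eqF.
have wxx : `|w (x z) - w (x z')| <= s / 4.
  apply: le_trans (lw _ _) _; apply: (@le_trans _ _ (L * (2 * B / N%:R))).
    by rewrite ler_wpM2l // ltW.
  have c0R : 0 < c%:R :> R by rewrite ltr0n.
  rewrite (_ : L * _ = (L * (2 * B) * 4 / r) / c%:R * (s / 4)).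
    rewrite -[leRHS]mul1r ler_wpM2r //; first by rewrite divr_ge0 // ltW.
    by rewrite ler_pdivrMr // mul1r.
  by rewrite /s /N natrM; field; rewrite !gt_eqF.
have gg : `|grid z - grid z'| < s.
  have -> : grid z - grid z' = (w (x z) - w (x z')) - (w (x z) - grid z)
      + (w (x z') - grid z').
    by apply/matrixP => a b; rewrite !mxE; lra.
  apply: le_lt_trans (ler_normD _ _) _.
  have := ler_normB (w (x z) - w (x z')) (w (x z) - grid z).
  have := xP z; have := xP z'; lra.
have := le_lt_trans (rV_coord_le _ i) gg; rewrite !mxE -mulrBl normrM (gtr0_norm s0).
rewrite gtr_pMl // ltNge; apply/negP; rewrite negbK.
have : (z i != z' i :> nat) by apply/eqP => /val_inj.
rewrite neq_ltn => /orP[] h; rewrite -(ler_nat R) -natr1 in h.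
  by rewrite ler0_norm; lra.
by rewrite ger0_norm; lra.
Qed.

(** A map from a compact space of dimension at most [k] to a Euclidean space of
    larger dimension can be moved slightly so that it avoids a neighbourhood of
    some point near the origin. *)
Lemma approx_missing_point (v : D -> 'rV[R]_m) (d r : R) :
  continuous v -> 0 < d -> 0 < r ->
  exists (w : D -> 'rV[R]_m) (q : 'rV[R]_m) (e : R),
    [/\ continuous w, forall x, `|w x - v x| <= d, 0 < e,
       forall i, 0 <= q 0 i <= r & forall x, e <= `|w x - q|].
Proof.
move=> cv d0 r0.
have [L [w [L0 wv lw]]] := lipschitz_approx cptD cj ij cv d0.
have [q [e [e0 qr wq]]] := lipschitz_misses L0 r0 lw.
by exists w, q, e; split => //; exact: lipschitz_continuous lw.
Qed.

End missing_point.

(** * The Euclidean norm and pushing to the sphere *)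

Section euclidean_norm.
Variables (R : realType) (n : nat).
Implicit Types x y : 'rV[R]_n.

Definition enorm x : R := Num.sqrt (\sum_(i < n) x 0 i ^+ 2).

Lemma sumsq_ge0 x : 0 <= \sum_(i < n) x 0 i ^+ 2.
Proof. by apply: sumr_ge0 => i _; exact: sqr_ge0. Qed.

Lemma enorm_ge0 x : 0 <= enorm x.
Proof. exact: sqrtr_ge0. Qed.

Lemma enorm_sqr x : enorm x ^+ 2 = \sum_(i < n) x 0 i ^+ 2.
Proof. exact: sqr_sqrtr (sumsq_ge0 x). Qed.

Lemma enorm_continuous : continuous enorm.
Proof.
exact: (continuous_compose (@sqrt_continuous R) (@sumsq_continuous R n)).
Qed.

Lemma ball_setE x : ball_set x <-> enorm x <= 1.
Proof.
by rewrite /ball_set /= -enorm_sqr expr_le1 // enorm_ge0.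
Qed.

Lemma sphere_setE x : sphere_set x <-> enorm x = 1.
Proof.
rewrite /sphere_set /= -enorm_sqr; split => [/eqP|->]; last by rewrite expr1n.
by rewrite sqrf_eq1 => /orP[/eqP //|/eqP x1]; have := enorm_ge0 x; rewrite x1; lra.
Qed.

Lemma enormZ (a : R) x : enorm (a *: x) = `|a| * enorm x.
Proof.
rewrite /enorm; under eq_bigr do rewrite mxE exprMn.
by rewrite -mulr_sumr sqrtrM ?sqr_ge0 // sqrtr_sqr.
Qed.

Lemma enormN x : enorm (- x) = enorm x.
Proof. by rewrite -scaleN1r enormZ normrN1 mul1r. Qed.

Lemma rV_norm_enorm x : `|x| <= enorm x.
Proof.
apply/rV_norm_le; first exact: enorm_ge0.
move=> i; rewrite -sqrtr_sqr ler_sqrt ?sumsq_ge0 //.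
by rewrite (bigD1 i) //= lerDl sumr_ge0 // => l _; exact: sqr_ge0.
Qed.

Lemma enorm_le_norm x : enorm x <= n%:R * `|x|.
Proof.
rewrite -(@ler_pXn2r _ 2) ?nnegrE ?enorm_ge0 ?mulr_ge0 // enorm_sqr exprMn.
apply: (@le_trans _ _ (\sum_(i < n) `|x| ^+ 2)).
  apply: ler_sum => i _; rewrite -real_normK ?num_real //.
  by rewrite lerXn2r ?nnegrE // rV_coord_le.
rewrite sumr_const card_ord -[leLHS]mulr_natl ler_wpM2r ?sqr_ge0 // -natrX ler_nat.
by rewrite expnS expn1; case: (n) => // k; rewrite leq_pmulr.
Qed.

Lemma enorm_eq0 x : enorm x = 0 -> x = 0.
Proof.
move=> x0; apply/eqP; rewrite -normr_eq0 eq_le normr_ge0 andbT -x0.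
exact: rV_norm_enorm.
Qed.

(** With [a] and [b] the norms of [x] and [y], the triangle inequality follows
    from the termwise inequality
    [(s + t)^2 <= (a + b) (s^2 / a + t^2 / b)]. *)
Lemma enormD x y : enorm (x + y) <= enorm x + enorm y.
Proof.
have := enorm_ge0 x; rewrite le_eqVlt => /orP[/eqP/esym x0|x0].
  by rewrite x0 (enorm_eq0 x0) !add0r.
have := enorm_ge0 y; rewrite le_eqVlt => /orP[/eqP/esym y0|y0].
  by rewrite y0 (enorm_eq0 y0) !addr0.
rewrite -(@ler_pXn2r _ 2) ?nnegrE ?addr_ge0 ?enorm_ge0 // enorm_sqr.
set a := enorm x in x0 *; set b := enorm y in y0 *.
have ab0 : 0 < a + b by rewrite addr_gt0.
apply: (@le_trans _ _
    (\sum_(i < n) (a + b) * (x 0 i ^+ 2 / a + y 0 i ^+ 2 / b))).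
  apply: ler_sum => i _; rewrite mxE -subr_ge0.
  rewrite (_ : _ - _ = (x 0 i * b - y 0 i * a) ^+ 2 / (a * b)).
    by rewrite divr_ge0 ?sqr_ge0 // mulr_ge0 // ltW.
  by field; rewrite !gt_eqF.
rewrite -mulr_sumr big_split /= -!mulr_suml -!enorm_sqr -/a -/b.
by rewrite expr2 ler_pM2l // !expr2 !mulfK // gt_eqF.
Qed.

Lemma enormB x y : enorm (x - y) <= enorm x + enorm y.
Proof. by rewrite -[in leRHS](enormN y); exact: enormD. Qed.

Lemma enorm_dist x y : `|enorm x - enorm y| <= enorm (x - y).
Proof.
have h u v : enorm u - enorm v <= enorm (u - v).
  by rewrite lerBlDr; apply: le_trans (enormD _ _); rewrite subrK.
by rewrite ler_norml h andbT lerNl opprB -[enorm (x - y)]enormN opprB h.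
Qed.

(** For [q] in the ball of radius 1/2, a self-map of the unit ball that fixes
    the sphere and sends [q] to the centre. *)
Definition recenter (q y : 'rV[R]_n) : 'rV[R]_n :=
  y - ((1 - enorm y) / (1 - enorm q)) *: q.

(** Projection to the sphere away from the point [q], damped where [recenter q]
    has norm at most [e] so as to remain continuous at [q]. *)
Definition push (q : 'rV[R]_n) (e : R) (y : 'rV[R]_n) : 'rV[R]_n :=
  (Num.max (enorm (recenter q y)) e)^-1 *: recenter q y.

Lemma push_continuous q e : 0 < e -> continuous (push q e).
Proof.
move=> e0.
have cr : continuous (recenter q).
  apply: cont_sub; first exact: continuous_idfun.
  apply: cont_scale; last exact: cst_continuous.
  apply: cont_mul; last exact: cst_continuous.
  apply: (@cont_sub R _ R^o); first exact: cst_continuous.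
  exact: enorm_continuous.
apply: cont_scale => //; apply: cont_inv.
  by move=> x; rewrite gt_eqF // lt_max e0 orbT.
apply: (@cont_max R _); last exact: cst_continuous.
exact: (continuous_compose enorm_continuous cr).
Qed.

Lemma push_le1 q e y : 0 < e -> enorm (push q e y) <= 1.
Proof.
move=> e0; have m0 : 0 < Num.max (enorm (recenter q y)) e by rewrite lt_max e0 orbT.
rewrite enormZ ger0_norm ?invr_ge0 ?(ltW m0) // mulrC ler_pdivrMr // mul1r.
by rewrite le_max lexx.
Qed.

Lemma push_sphere q e y : e <= 1 -> enorm y = 1 -> push q e y = y.
Proof.
move=> e1 y1; rewrite /push /recenter y1 subrr mul0r scale0r subr0 y1.
by rewrite max_l // invr1 scale1r.
Qed.

(** As [q] is in the ball of radius 1/4, [recenter q y] differs from [y - q] by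
    a vector of norm at most a third of that of [y - q]. *)
Lemma push_far q e y : 0 < e -> enorm q <= 1 / 4 ->
  3 / 2 * e <= enorm (y - q) -> enorm (push q e y) = 1.
Proof.
move=> e0 q4 yq; have q0 := enorm_ge0 q.
suff ey : e <= enorm (recenter q y).
  have r0 : 0 < enorm (recenter q y) := lt_le_trans e0 ey.
  by rewrite /push max_l // enormZ gtr0_norm ?invr_gt0 // mulVf // gt_eqF.
have -> : recenter q y = (y - q) + ((enorm y - enorm q) / (1 - enorm q)) *: q.
  apply/matrixP => i l; rewrite /recenter !mxE; field.
  by rewrite gt_eqF //; lra.
set z := (X in _ + X).
have : enorm (y - q) <= enorm (y - q + z) + enorm z.
  by rewrite -[in leLHS](addrK z (y - q)); exact: enormB.
have : enorm z <= enorm (y - q) / 3.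
  rewrite /z enormZ normrM normfV (@ger0_norm _ (1 - _)); last lra.
  have := enorm_dist y q; have := normr_ge0 (enorm y - enorm q).
  set u := `|_|; set w := enorm (y - q) => u0 uw.
  apply: (@le_trans _ _ (u / 3)); last by rewrite ler_wpM2r // invr_ge0.
  rewrite -mulrA ler_wpM2l // mulrC ler_pdivrMr; last lra.
  lra.
lra.
Qed.

End euclidean_norm.

Section cutoff.
Variables (R : realType) (n : nat).

Definition cutoff (y : 'rV[R]_n) : R := Num.min 1 (2 * (1 - enorm y)).

Lemma cutoff_continuous : continuous cutoff.
Proof.
apply: cont_min; first exact: cst_continuous.
apply: cont_mul; first exact: cst_continuous.
apply: (@cont_sub R _ R^o); first exact: cst_continuous.
exact: enorm_continuous.
Qed.

Lemma cutoff_ge0 y : enorm y <= 1 -> 0 <= cutoff y.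
Proof. by move=> y1; rewrite /cutoff le_min ler01 /=; lra. Qed.

Lemma cutoff_le1 y : cutoff y <= 1.
Proof. by rewrite /cutoff ge_min lexx. Qed.

Lemma cutoff_half y : enorm y <= 1 / 2 -> cutoff y = 1.
Proof. by move=> y2; rewrite /cutoff min_l //; lra. Qed.

Lemma cutoff_sphere y : enorm y = 1 -> cutoff y = 0.
Proof. by move=> y1; rewrite /cutoff y1 subrr mulr0 min_r. Qed.

End cutoff.

(** * Intervals, balls and concatenation of homotopies *)

Section unit_interval.
Variable R : realType.

Lemma I01_itv (t : I01 R) : 0 <= sval t <= 1.
Proof. by have := set_mem (svalP t); rewrite /unit_interval /= in_itv. Qed.

Lemma I01_compact : compact [set: I01 R].
Proof. by apply: compact_set_type; exact: segment_compact. Qed.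

Lemma I01_hausdorff : hausdorff_space (I01 R).
Proof. by apply: set_type_hausdorff; exact: (@norm_hausdorff _ R^o). Qed.

(** Real numbers are clamped into the unit interval: formulas for homotopies
    can then be written with real arithmetic, without side conditions. *)
Lemma clampI_subproof (r : R) : unit_interval (Num.max 0 (Num.min 1 r)).
Proof.
by rewrite /unit_interval /= in_itv /= le_max lexx /= ge_max ler01 ge_min lexx.
Qed.

Definition clampI (r : R) : I01 R :=
  exist (fun x : R => x \in @unit_interval R) _ (mem_set (clampI_subproof r)).

Lemma clampI_val r : sval (clampI r) = Num.max 0 (Num.min 1 r).
Proof. by []. Qed.

Lemma clampI_continuous : continuous clampI.
Proof.
apply: (@set_type_continuous R R (@unit_interval R)).
apply: cont_max; first exact: cst_continuous.
by apply: cont_min; [exact: cst_continuous|exact: continuous_idfun].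
Qed.

Lemma I01_inj (s t : I01 R) : sval s = sval t -> s = t.
Proof. exact: val_inj. Qed.

Lemma clampI_id (t : I01 R) : clampI (sval t) = t.
Proof.
apply: I01_inj; rewrite clampI_val; have /andP[t0 t1] := I01_itv t.
by rewrite min_r // max_r.
Qed.

Lemma clampI0 (r : R) : r <= 0 -> clampI r = I0 R.
Proof.
move=> r0; apply: I01_inj; rewrite clampI_val min_r ?max_l //.
by apply: le_trans r0 _.
Qed.

Lemma clampI1 (r : R) : 1 <= r -> clampI r = I1 R.
Proof. by move=> r1; apply: I01_inj; rewrite clampI_val min_l // max_r. Qed.

Lemma I01_val_continuous : continuous (fun t : I01 R => sval t : R).
Proof. exact: set_val_continuous. Qed.

End unit_interval.

Section balls.
Variables (R : realType) (n : nat).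

Definition mkball (x : 'rV[R]_n) (x1 : enorm x <= 1) : Ball R n :=
  exist (fun x => x \in @ball_set R n) x (mem_set ((ball_setE x).2 x1)).

Lemma ball_enorm (b : Ball R n) : enorm (sval b) <= 1.
Proof. by apply/ball_setE; exact: set_mem (svalP b). Qed.

Lemma sphere_enorm (b : Sphere R n) : enorm (sval b) = 1.
Proof. by apply/sphere_setE; exact: set_mem (svalP b). Qed.

Lemma ball_val_continuous : continuous (fun b : Ball R n => sval b : 'rV[R]_n).
Proof. exact: set_val_continuous. Qed.

Lemma ball_inj (b c : Ball R n) : sval b = sval c -> b = c.
Proof. exact: val_inj. Qed.

Lemma ball_compact : compact [set: Ball R n].
Proof.
apply: compact_set_type.
have cc := @rV_compact R n (fun=> `[-1, 1]%classic) (fun=> @segment_compact R _ _).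
apply: subclosed_compact cc _.
  have -> : @ball_set R n = (@enorm R n) @^-1` [set r | r <= 1].
    by apply/seteqP; split => x /ball_setE.
  by apply: closed_comp => [x _|]; [exact: enorm_continuous|exact: closed_le].
move=> x /ball_setE x1 i /=; rewrite in_itv /= -ler_norml.
by apply: le_trans (rV_coord_le x i) (le_trans (rV_norm_enorm x) x1).
Qed.

End balls.

Section concatenation.
Variables (R : realType) (X Z : topologicalType).

Definition concat (H1 H2 : X * I01 R -> Z) (p : X * I01 R) : Z :=
  if sval p.2 <= 1 / 2 then H1 (p.1, clampI (2 * sval p.2))
  else H2 (p.1, clampI (2 * sval p.2 - 1)).

Variables (H1 H2 : X * I01 R -> Z).
Hypothesis H12 : forall x, H1 (x, I1 R) = H2 (x, I0 R).

Lemma concat_continuous : continuous H1 -> continuous H2 ->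
  continuous (concat H1 H2).
Proof.
move=> c1 c2.
have ct : continuous (fun p : X * I01 R => sval p.2 : R).
  exact: (continuous_snd (@I01_val_continuous R)).
have c2t : continuous (fun p : X * I01 R => 2 * sval p.2 : R).
  by apply: (@cont_mul R _); first exact: cst_continuous.
apply: (@glue_continuous _ _ [set p : X * I01 R | sval p.2 <= 1 / 2]
   [set p : X * I01 R | 1 / 2 <= sval p.2]
   (fun p => H1 (p.1, clampI (2 * sval p.2)))
   (fun p => H2 (p.1, clampI (2 * sval p.2 - 1)))).
- apply: (@closed_comp _ _ (fun p : X * I01 R => sval p.2 : R) [set r | r <= 1 / 2]).
    by move=> x _; exact: ct.
  exact: closed_le.
- apply: (@closed_comp _ _ (fun p : X * I01 R => sval p.2 : R) [set r | 1 / 2 <= r]).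
    by move=> x _; exact: ct.
  exact: closed_ge.
- by move=> p /=; have [h|/ltW h] := leP (sval p.2) (1 / 2); [left|right].
- move=> p _; move: p; apply: (continuous_compose c1).
  apply: continuous_pair; first by move=> p; exact: cvg_fst.
  exact: (continuous_compose (@clampI_continuous R)).
- move=> p _; move: p; apply: (continuous_compose c2).
  apply: continuous_pair; first by move=> p; exact: cvg_fst.
  apply: (continuous_compose (@clampI_continuous R)).
  by apply: (@cont_sub R _ R^o); last exact: cst_continuous.
- by move=> p /= h; rewrite /concat h.
- move=> [x t] /=; rewrite /concat le_eqVlt => /orP[/eqP/= h|]; last first.
    by move=> /= h; rewrite leNgt h.
  by rewrite -h lexx clampI1 ?clampI0 ?H12 //; lra.
Qed.

Lemma concat0 x : concat H1 H2 (x, I0 R) = H1 (x, I0 R).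
Proof. by rewrite /concat /= mulr0 clampI0 // divr_ge0. Qed.

Lemma concat1 x : concat H1 H2 (x, I1 R) = H2 (x, I1 R).
Proof. by rewrite /concat /= ifF ?clampI1 //; last apply/negbTE; rewrite -?ltNge; lra. Qed.

Lemma concat_ind (P : Z -> Prop) p : (forall t, P (H1 (p.1, t))) ->
  (forall t, P (H2 (p.1, t))) -> P (concat H1 H2 p).
Proof. by move=> P1 P2; rewrite /concat; case: ifP. Qed.

End concatenation.

(** * Compression into a skeleton *)

Section compression.
Variables (R : realType) (Y : topologicalType) (K : cw_complex R Y).
Local Notation skel := (cw_skel_space K).
Local Notation incl n := (@cw_incl R Y K n).

Section one_step.
Variable m : nat.

(** The characteristic maps identify each open cell with an open ball.
    Multiplying this identification by a function that vanishes on the sphere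
    makes it extend by 0 to the lower skeleton, so that a single map gives, near
    the centres, the coordinates in all cells at once. *)
Lemma cell_coordinate : exists c : skel m.+1 -> 'rV[R]_m.+1,
  continuous c /\ forall p, c (cw_char p) = cutoff (sval p.2) *: sval p.2.
Proof.
have [_ [_ univ]] := @cw_pushout _ _ K m.
have [|||c [[cc _ ccell] _]] := univ 'rV[R]_m.+1 (fun=> 0)
    (fun p => cutoff (sval p.2) *: sval p.2).
- exact: cst_continuous.
- apply: (continuous_snd (f := fun b : Ball R m.+1 => cutoff (sval b) *: sval b)).
  apply: cont_scale; last exact: ball_val_continuous.
  exact: (continuous_compose (@cutoff_continuous R m.+1) (@ball_val_continuous R m.+1)).
- apply/funext => p /=.
  by rewrite cutoff_sphere ?scale0r // -(sphere_enorm p.2).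
exists c; split => // p.
exact: (congr1 (fun h => h p) ccell).
Qed.

Variables (D : topologicalType) (k : nat) (j : D -> 'rV[R]_k).
Hypothesis cptD : compact [set: D].
Hypothesis cj : continuous j.
Hypothesis ij : injective j.
Hypothesis km : (k < m.+1)%N.

Section cell_move.
Variables (q : 'rV[R]_m.+1) (e : R) (d : D -> 'rV[R]_m.+1).
Hypothesis e0 : 0 < e.

(** Near the centre of its cell, the point with coordinate [b] is displaced by
    [d x], a vector chosen so that it avoids [q]; then it is pushed
    away from [q]. The displacement is cut off near the boundary. *)
Definition moved (b : Ball R m.+1) (x : D) : 'rV[R]_m.+1 :=
  push q e (sval b + cutoff (sval b) *: d x).

Lemma cell_move_subproof (b : Ball R m.+1) (p : D * I01 R) :
  enorm ((1 - sval p.2) *: sval b + sval p.2 *: moved b p.1) <= 1.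
Proof.
have /andP[t0 t1] := I01_itv p.2.
have : enorm (moved b p.1) <= 1 by exact: push_le1.
move: (moved b p.1) => y y1.
apply: le_trans (enormD _ _) _; rewrite !enormZ !ger0_norm //; last by rewrite subr_ge0.
have : (1 - sval p.2) * enorm (sval b) <= (1 - sval p.2) * 1.
  by rewrite ler_wpM2l ?subr_ge0 // ball_enorm.
have : sval p.2 * enorm y <= sval p.2 * 1 by rewrite ler_wpM2l.
lra.
Qed.

(** Balls are convex: the point moves along a segment. It stays in place if it is
    on the sphere, so that the motions in the different cells glue. *)
Definition cell_move (b : Ball R m.+1) (p : D * I01 R) : Ball R m.+1 :=
  mkball (cell_move_subproof b p).

Lemma cell_move_continuous : continuous d ->
  continuous (fun z : Ball R m.+1 * (D * I01 R) => cell_move z.1 z.2).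
Proof.
move=> cd; apply: set_type_continuous.
have ct : continuous (fun z : Ball R m.+1 * (D * I01 R) => sval z.2.2 : R).
  apply: (@continuous_snd _ _ _ (fun p : D * I01 R => sval p.2 : R)).
  by apply: continuous_snd; exact: I01_val_continuous.
have cb : continuous (fun z : Ball R m.+1 * (D * I01 R) => sval z.1 : 'rV[R]_m.+1).
  by apply: continuous_fst; exact: ball_val_continuous.
have cdx : continuous (fun z : Ball R m.+1 * (D * I01 R) => d z.2.1).
  by apply: (@continuous_snd _ _ _ (fun p : D * I01 R => d p.1)); exact: continuous_fst.
apply: cont_add; apply: cont_scale => //.
  by apply: (@cont_sub R _ R^o) => //; exact: cst_continuous.
have cg : continuous (fun z : Ball R m.+1 * (D * I01 R) =>
    sval z.1 + cutoff (sval z.1) *: d z.2.1).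
  apply: cont_add => //; apply: cont_scale => //.
  exact: (continuous_compose (@cutoff_continuous R m.+1) cb).
exact: (continuous_compose (@push_continuous R m.+1 q e e0) cg).
Qed.

End cell_move.

(** The coordinate map composed with [phi] goes to dimension [m+1 > k], so a
    small displacement [d] makes it miss a point [q] by some distance. In each
    cell, the displaced point can then be pushed from [q] out to the boundary
    sphere. The motion depends on the point [x] of [D], not only on [phi x]: it
    is built on the product of the skeleton with [D * I01], where the pushout
    property provides continuity. *)
Lemma compress_step (phi : D -> skel m.+1) : continuous phi ->
  exists h : D * I01 R -> skel m.+1, [/\ continuous h,
    forall x, h (x, I0 R) = phi x,
    forall x, range (@cw_step R Y K m) (h (x, I1 R)) &
    forall x t, range (@cw_step R Y K m) (phi x) -> h (x, t) = phi x].
Proof.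
move=> cphi; have [c [cc cE]] := cell_coordinate.
pose v := c \o phi.
have cv : continuous v by exact: continuous_compose.
have M0 : 0 < m.+1%:R :> R by rewrite ltr0n.
have [||w [q [e [cw wv e0 qr wq]]]] := approx_missing_point cptD cj ij km
  (d := 1 / 8 / m.+1%:R) (r := 1 / 4 / m.+1%:R) cv.
- by rewrite divr_gt0.
- by rewrite divr_gt0.
pose d x := w x - v x.
have d8 x : enorm (d x) <= 1 / 8.
  apply: le_trans (enorm_le_norm _) _.
  by rewrite mulrC -ler_pdivlMr //; exact: wv.
have q4 : enorm q <= 1 / 4.
  apply: le_trans (enorm_le_norm _) _; rewrite mulrC -ler_pdivlMr //.
  apply/rV_norm_le; first by rewrite divr_ge0.
  by move=> i; have /andP[qi0 qi] := qr i; rewrite ger0_norm.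
(* The distance from [q] that is guaranteed below is [e] for [b] in the half
   ball, and 1/2 - 1/8 - 1/4 = 1/8 elsewhere; [push_far] loses a factor 3/2. *)
pose e' := Num.min (1 / 12) (2 / 3 * e).
have e'0 : 0 < e' by rewrite lt_min; apply/andP; split; lra.
have e'12 : e' <= 1 / 12 by rewrite ge_min lexx.
have e'e : 3 / 2 * e' <= e.
  have : e' <= 2 / 3 * e by rewrite ge_min lexx orbT.
  lra.
pose V := (D * I01 R)%type.
have cptV : compact [set: V] := compact_prod cptD (@I01_compact R).
have hV : hausdorff_space V.
  apply: hausdorff_prod; last exact: I01_hausdorff.
  exact: (hausdorff_injective cj ij (@norm_hausdorff _ _)).
have [|||W [cW Wstep Wchar]] := @pushout_times V _ _ _ _ _ _ _ _
  (compact_locally_compact cptV) hV (@cw_pushout _ _ K m) (skel m.+1)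
  (fun p => cw_step p.1)
  (fun p => cw_char (p.1.1, cell_move q d e'0 p.1.2 p.2)).
- by apply: continuous_fst; exact: cw_step_continuous.
- have [[_ _ _ cchar] _] := @cw_pushout _ _ K m.
  apply: (continuous_compose cchar); apply: continuous_pair.
    by apply: continuous_fst => p; exact: cvg_fst.
  apply: (continuous_compose (@cell_move_continuous q e' d e'0 _)
    (f := fun p : (discrete_topology (cw_cells K m.+1) * Ball R m.+1) * V =>
       (p.1.2, p.2))).
    exact: cont_sub.
  apply: continuous_pair => p; last exact: cvg_snd.
  by apply: (@cvg_comp _ _ _ fst snd); [exact: cvg_fst|exact: cvg_snd].
- move=> p [x t]; rewrite cw_attach_step; congr cw_char.
  rewrite [LHS]surjective_pairing; congr pair; apply: ball_inj => /=.
  rewrite /moved cutoff_sphere ?sphere_enorm // scale0r addr0.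
  rewrite push_sphere ?sphere_enorm //; last by apply: le_trans e'12 _; lra.
  by rewrite -scalerDl subrK scale1r.
have cover y := pushout_cover (@cw_pushout _ _ K m) y.
exists (fun p => W (phi p.1, p)); split.
- apply: (continuous_compose cW); apply: continuous_pair; last exact: continuous_idfun.
  exact: continuous_fst.
- move=> x /=; have [[y ->]|[p ->]] := cover (phi x); first by rewrite Wstep.
  rewrite Wchar /=; congr cw_char; rewrite [RHS]surjective_pairing; congr pair.
  by apply: ball_inj; rewrite /= subr0 scale1r scale0r addr0.
- move=> x /=; have [[y ->]|[p px]] := cover (phi x).
    by rewrite Wstep; exists y.
  rewrite px Wchar /=; set b' := cell_move _ _ _ _ _.
  suff Sb' : sphere_set (sval b').
    exists (cw_attach (p.1, ball_bdry Sb')) => //.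
    rewrite cw_attach_step; congr cw_char.
    exact: (cell_incl_bdry (p := (p.1, b')) Sb').
  apply/sphere_setE; rewrite /= subrr scale0r add0r scale1r /moved.
  apply: push_far => //; set b := sval p.2.
  have vb : v x = cutoff b *: b by rewrite /v /= px cE.
  have [b2|b2] := lerP (enorm b) (1 / 2).
    rewrite cutoff_half // scale1r /d vb cutoff_half // scale1r.
    rewrite addrCA subrr addr0; apply: le_trans e'e _.
    by apply: le_trans (wq x) _; exact: rV_norm_enorm.
  have := enorm_dist (b + cutoff b *: d x) q.
  have : enorm (cutoff b *: d x) <= 1 / 8.
    rewrite enormZ ger0_norm ?cutoff_ge0 ?ball_enorm //.
    apply: le_trans (d8 x); rewrite ler_piMl ?enorm_ge0 ?cutoff_le1 //.
  have := enorm_dist b (- (cutoff b *: d x)); rewrite opprK enormN.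
  rewrite !ler_norml => /andP[_ h1] h2 /andP[_ h3].
  lra.
- move=> x t [y _ yx] /=.
  by rewrite -yx Wstep.
Qed.

End one_step.

Section all_steps.
Variables (D : topologicalType) (k : nat) (j : D -> 'rV[R]_k).
Hypothesis cptD : compact [set: D].
Hypothesis cj : continuous j.
Hypothesis ij : injective j.

(** By compactness [phi] lands in some [N]-skeleton, and the previous lemma is
    applied from dimension [N] down to [n + 1]. At each stage the map is lifted
    to the skeleton it lands in, so that the next stage can start. *)
Lemma compress n (phi : D -> Y) : (k <= n)%N -> continuous phi ->
  exists h : D * I01 R -> Y, [/\ continuous h,
    forall x, h (x, I0 R) = phi x,
    forall x, cw_skeleton K n (h (x, I1 R)) &
    forall x t, cw_skeleton K n (phi x) -> h (x, t) = phi x].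
Proof.
move=> kn cphi; have [N phiN] := cw_compact_skeleton K cptD cphi.
elim: N phi cphi phiN => [|N IH] phi cphi phiN.
  exists (fun p => phi p.1); split => //; first exact: continuous_fst.
  by move=> x; apply: cw_skeleton_mono (phiN x).
have [Nn|nN] := leqP N.+1 n.
  exists (fun p => phi p.1); split => //; first exact: continuous_fst.
  by move=> x; apply: cw_skeleton_mono (phiN x).
have [psi cpsi psiE] := cw_lift cphi phiN.
have [h [ch h0 h1 hrel]] := compress_step cptD cj ij (leq_ltn_trans kn nN) cpsi.
have [||h' [ch' h'0 h'1 h'rel]] := IH (fun x => incl N.+1 (h (x, I1 R))).
- apply: (continuous_compose (@cw_incl_continuous R Y K N.+1)).
  apply: (continuous_compose ch); apply: continuous_pair.
    exact: continuous_idfun.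
  exact: cst_continuous.
- by move=> x; have [y _ <-] := h1 x; exists y => //; rewrite cw_incl_step.
have hn x t : cw_skeleton K n (phi x) -> incl N.+1 (h (x, t)) = phi x.
  move=> phin; rewrite hrel ?psiE //.
  have [y _ yx] : cw_skeleton K N (phi x).
    exact: cw_skeleton_mono phin.
  exists y => //; apply: (@cw_incl_inj R Y K N.+1).
  by rewrite cw_incl_step psiE.
exists (concat (incl N.+1 \o h) h'); split.
- apply: concat_continuous; [by move=> x; rewrite h'0| |exact: ch'].
  exact: (continuous_compose (@cw_incl_continuous R Y K N.+1) ch).
- by move=> x; rewrite concat0 /= h0 psiE.
- by move=> x; rewrite concat1.
- move=> x t phin; apply: (concat_ind (P := fun y => y = phi x)) => s /=.
    exact: hn.
  by rewrite h'rel hn.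
Qed.

End all_steps.
End compression.

(** * Extending a homotopy over a cell *)

Section ball_retraction.
Variables (R : realType) (n : nat).

Lemma retract_subproof (x : 'rV[R]_n) : enorm ((Num.max 1 (enorm x))^-1 *: x) <= 1.
Proof.
have m0 : 0 < Num.max 1 (enorm x) by rewrite lt_max ltr01.
rewrite enormZ gtr0_norm ?invr_gt0 // mulrC ler_pdivrMr // mul1r.
by rewrite le_max lexx orbT.
Qed.

Definition retract (x : 'rV[R]_n) : Ball R n := mkball (retract_subproof x).

Lemma retract_continuous : continuous retract.
Proof.
apply: set_type_continuous; apply: cont_scale; last exact: continuous_idfun.
apply: cont_inv; first by move=> x; rewrite gt_eqF // lt_max ltr01.
apply: cont_max; first exact: cst_continuous.
exact: enorm_continuous.
Qed.

Lemma retract_val (x : 'rV[R]_n) : enorm x <= 1 -> sval (retract x) = x.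
Proof. by move=> x1; rewrite /= max_l // invr1 scale1r. Qed.

End ball_retraction.

Section direction.
Variables (R : realType) (n : nat).

(** Default value for the direction of the zero vector. *)
Definition pole : 'rV[R]_n.+1 := \row_i (i == 0)%:R.

Definition unit_vector (x : 'rV[R]_n.+1) : 'rV[R]_n.+1 :=
  if enorm x == 0 then pole else (enorm x)^-1 *: x.

Lemma unit_vector_subproof x : sphere_set (unit_vector x).
Proof.
rewrite /unit_vector; have [x0|x0] := eqVneq (enorm x) 0.
  rewrite /sphere_set /= (bigD1 0) //= big1; last first.
    by move=> i /negbTE i0; rewrite mxE i0 expr0n.
  by rewrite mxE eqxx expr1n addr0.
apply/sphere_setE; rewrite enormZ ger0_norm ?invr_ge0 ?enorm_ge0 //.
by rewrite mulVf.
Qed.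

Definition direction (x : 'rV[R]_n.+1) : Sphere R n.+1 :=
  exist (fun x => x \in @sphere_set R n.+1) _ (mem_set (unit_vector_subproof x)).

Lemma direction_val x : enorm x != 0 -> sval (direction x) = (enorm x)^-1 *: x.
Proof. by move=> /negbTE x0; rewrite /= /unit_vector x0. Qed.

(** Near [x] the norm is bounded below by half of that of [x], so the inverse
    of the norm may be replaced there by a function that is continuous
    everywhere. *)
Lemma direction_continuous x : enorm x != 0 -> {for x, continuous direction}.
Proof.
move=> x0 U [_ [[W oW <-] /= Wx WU]].
have nx : 0 < enorm x by rewrite lt_neqAle eq_sym x0 enorm_ge0.
pose g (y : 'rV[R]_n.+1) := (Num.max (enorm y) (enorm x / 2))^-1 *: y.
have cg : continuous g.
  apply: cont_scale; last exact: continuous_idfun.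
  apply: cont_inv; first by move=> y; rewrite gt_eqF // lt_max; apply/orP; right; lra.
  apply: cont_max; last exact: cst_continuous.
  exact: enorm_continuous.
have gE y : enorm x / 2 < enorm y -> g y = sval (direction y).
  move=> y2; rewrite direction_val; last by rewrite gt_eqF //; lra.
  by rewrite /g max_l // ltW.
have Wn : nbhs x [set y | W (g y)].
  apply: cg; apply: open_nbhs_nbhs; split => //.
  by rewrite gE //; lra.
have n2 : \forall y \near x, enorm x / 2 < enorm y.
  by apply: (near_gt (@enorm_continuous R n.+1)); lra.
apply: filterS (filterI Wn n2) => y [Wy y2]; apply: WU => /=.
by move: Wy; rewrite /= gE.
Qed.

Lemma direction_sphere (a : R) (s : Sphere R n.+1) :
  0 < a -> direction (a *: sval s) = s.
Proof.
move=> a0; apply: val_inj.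
have na : enorm (a *: sval s) = a by rewrite enormZ sphere_enorm mulr1 gtr0_norm.
rewrite -[val _]/(sval (direction (a *: sval s))) direction_val na ?gt_eqF //.
by rewrite scalerA mulVf ?gt_eqF // scale1r.
Qed.

End direction.

Section cell_homotopy.
Variables (R : realType) (Y : topologicalType) (K : cw_complex R Y).
Variables (T : topologicalType) (l : nat) (jT : T -> 'rV[R]_l).
Hypothesis cptT : compact [set: T].
Hypothesis cjT : continuous jT.
Hypothesis ijT : injective jT.
Variables (A : set T) (n N : nat).
Hypothesis nN : (n.+1 + l <= N)%N.
Variables (F : Ball R n.+1 * T -> Y) (G : Sphere R n.+1 * (T * I01 R) -> Y).
Hypothesis cF : continuous F.
Hypothesis cG : continuous G.
Hypothesis G0 : forall s t, G (s, (t, I0 R)) = F (sphere_incl s, t).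
Hypothesis G1 : forall s t, cw_skeleton K N (G (s, (t, I1 R))).
Hypothesis FA : forall b t, A t -> cw_skeleton K N (F (b, t)).
Hypothesis GA : forall s t u, A t -> cw_skeleton K N (G (s, (t, u))).

(** The map [F] squeezed to the ball of radius 1/2, surrounded by the track of
    the homotopy [G] of its restriction to the sphere. *)
Definition collar (p : Ball R n.+1 * T) : Y :=
  if enorm (sval p.1) <= 1 / 2 then F (retract (2 *: sval p.1), p.2)
  else G (direction (sval p.1), (p.2, clampI (2 * enorm (sval p.1) - 1))).

Lemma collar_outer b t : 1 / 2 <= enorm (sval b) ->
  collar (b, t) = G (direction (sval b), (t, clampI (2 * enorm (sval b) - 1))).
Proof.
rewrite /collar /= => b2; have [b2'|//] := leP (enorm (sval b)) (1 / 2).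
have eb : enorm (sval b) = 1 / 2 by apply/le_anti/andP.
rewrite clampI0; last by rewrite eb; lra.
rewrite G0; congr (F (_, t)); apply: ball_inj.
rewrite retract_val; last by rewrite enormZ eb ger0_norm //; lra.
rewrite /= -[unit_vector _]/(sval (direction (sval b))) direction_val eb.
  by congr (_ *: _); lra.
by rewrite gt_eqF //; lra.
Qed.

Lemma collar_continuous : continuous collar.
Proof.
have cb : continuous (fun p : Ball R n.+1 * T => sval p.1 : 'rV[R]_n.+1).
  by apply: continuous_fst; exact: ball_val_continuous.
have ce : continuous (fun p : Ball R n.+1 * T => enorm (sval p.1)).
  exact: (continuous_compose (@enorm_continuous R n.+1) cb).
have c2 : continuous (@snd (Ball R n.+1) T) by move=> p; exact: cvg_snd.
apply: (@glue_continuous _ _ [set p : Ball R n.+1 * T | enorm (sval p.1) <= 1 / 2]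
   [set p : Ball R n.+1 * T | 1 / 2 <= enorm (sval p.1)]
   (fun p => F (retract (2 *: sval p.1), p.2))
   (fun p => G (direction (sval p.1), (p.2, clampI (2 * enorm (sval p.1) - 1))))).
- apply: (@closed_comp _ _ (fun p : Ball R n.+1 * T => enorm (sval p.1)) [set r | r <= 1 / 2]).
    by move=> x _; exact: ce.
  exact: closed_le.
- apply: (@closed_comp _ _ (fun p : Ball R n.+1 * T => enorm (sval p.1)) [set r | 1 / 2 <= r]).
    by move=> x _; exact: ce.
  exact: closed_ge.
- by move=> p /=; have [h|/ltW h] := leP (enorm (sval p.1)) (1 / 2); [left|right].
- move=> p _; move: p; apply: (continuous_compose cF).
  apply: continuous_pair => //.
  apply: (continuous_compose (@retract_continuous R n.+1)).
  by apply: cont_scale => //; exact: cst_continuous.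
- move=> p /= p2; have p0 : enorm (sval p.1) != 0 by rewrite gt_eqF //; lra.
  have cd : {for p, continuous (fun p : Ball R n.+1 * T => direction (sval p.1))}.
    apply: (@continuous_comp _ _ _ (fun p : Ball R n.+1 * T => sval p.1 : 'rV[R]_n.+1)
      (@direction R n)); first exact: cb.
    exact: direction_continuous.
  have cc : continuous (fun p : Ball R n.+1 * T =>
      (p.2, clampI (2 * enorm (sval p.1) - 1))).
    apply: continuous_pair => //.
    apply: (continuous_compose (@clampI_continuous R)).
    apply: (@cont_sub R _ R^o); last exact: cst_continuous.
    by apply: cont_mul => //; exact: cst_continuous.
  apply: (@continuous_comp _ _ _ (fun p : Ball R n.+1 * T =>
    (direction (sval p.1), (p.2, clampI (2 * enorm (sval p.1) - 1)))) G).
    by apply: (@cvg_pair _ _ _ _ (nbhs (direction (sval p.1))) (nbhs (_ : T * I01 R)));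
      [exact: cd|exact: cc].
  exact: cG.
- by move=> p /= h; rewrite /collar h.
- by move=> [b t] /= h; rewrite collar_outer.
Qed.

(** The factor by which the homotopy below moves the point [b] radially at time
    [s]. It makes [collar] traverse [F] itself at time 0, as the factor is then
    1/2; on the sphere it is [(1 + s) / 2], which makes [collar] run through
    [G]; at time 1 it sends the inner half ball onto the whole ball and the
    outer shell onto the sphere. The constant 1/4 keeps the quotient
    defined and is invisible in the minimum. *)
Definition stretch (b : 'rV[R]_n.+1) (s : R) : R :=
  Num.min ((1 + 3 * s) / 2) ((1 + s) / (2 * Num.max (enorm b) (1 / 4))).

Lemma stretch0 b : enorm b <= 1 -> stretch b 0 = 1 / 2.
Proof.
move=> b1; rewrite /stretch mulr0 !addr0 min_l //.
have m0 : 0 < Num.max (enorm b) (1 / 4) by rewrite lt_max; apply/orP; right; lra.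
have m1 : Num.max (enorm b) (1 / 4) <= 1 by rewrite ge_max b1 /=; lra.
rewrite ler_pdivlMr ?mulr_gt0 //; lra.
Qed.

Lemma stretch_sphere b s : 0 <= s -> enorm b = 1 -> stretch b s = (1 + s) / 2.
Proof.
move=> s0 b1; rewrite /stretch b1 max_l; last lra.
by rewrite mulr1 min_r //; lra.
Qed.

Lemma stretch1 b : 1 / 2 <= enorm b -> stretch b 1 = (enorm b)^-1.
Proof.
move=> b2; have b0 : 0 < enorm b by lra.
rewrite /stretch max_l; last lra.
have -> : (1 + 1) / (2 * enorm b) = (enorm b)^-1 by field; rewrite gt_eqF.
rewrite min_r // -[leLHS]mul1r ler_pdivrMr //; lra.
Qed.

(** Homotopy extension and compression in one homotopy. Let [h] compress
    [collar] into the [N]-skeleton, relative to the points already there. At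
    time [s] the point [b] is moved by [stretch] and then [h] is run up to time
    [cutoff b * s]. On the sphere the cutoff is 0, hence [H] extends [G]. At
    time 1, either [b] is in the inner half ball and [h] has been run to its
    end, or [b] has been moved to the sphere, where [collar] is already in the
    skeleton and [h] does not move it. *)
Lemma cell_homotopy : exists H : Ball R n.+1 * (T * I01 R) -> Y,
  [/\ continuous H, forall b t, H (b, (t, I0 R)) = F (b, t),
      forall s v, H (sphere_incl s, v) = G (s, v),
      forall b t, cw_skeleton K N (H (b, (t, I1 R))) &
      forall b t u, A t -> cw_skeleton K N (H (b, (t, u)))].
Proof.
pose D := (Ball R n.+1 * T)%type.
pose j (p : D) : 'rV[R]_(n.+1 + l) := row_mx (sval p.1) (jT p.2).
have cptD : compact [set: D] := compact_prod (@ball_compact R n.+1) cptT.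
have cj : continuous j.
  apply: rV_continuous => i; rewrite /j; case: (splitP i) => i' ii'.
    have -> : i = lshift l i' by exact: val_inj.
    have -> : (fun t : D => row_mx (sval t.1) (jT t.2) 0 (lshift l i')) =
        (fun t : D => sval t.1 0 i') by apply/funext => t; rewrite row_mxEl.
    apply: (continuous_compose (@coord_continuous R 1 n.+1 0 i')
      (f := fun p : D => sval p.1 : 'rV[R]_n.+1)).
    by apply: continuous_fst; exact: ball_val_continuous.
  have -> : i = rshift n.+1 i' by exact: val_inj.
  have -> : (fun t : D => row_mx (sval t.1) (jT t.2) 0 (rshift n.+1 i')) =
      (fun t : D => jT t.2 0 i') by apply/funext => t; rewrite row_mxEr.
  apply: (continuous_compose (@coord_continuous R 1 l 0 i')
    (f := fun p : D => jT p.2)).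
  exact: continuous_snd.
have ij : injective j.
  move=> [b t] [b' t'] /eq_row_mx[/= bb tt]; congr pair; last exact: ijT.
  exact: ball_inj.
have [h [ch h0 h1 hrel]] := compress K cptD cj ij nN collar_continuous.
pose H (z : Ball R n.+1 * (T * I01 R)) : Y :=
  h ((retract (stretch (sval z.1) (sval z.2.2) *: sval z.1), z.2.1),
     clampI (cutoff (sval z.1) * sval z.2.2)).
exists H; split.
- have cs : continuous (fun z : Ball R n.+1 * (T * I01 R) => sval z.2.2 : R).
    apply: (@continuous_snd _ _ _ (fun p : T * I01 R => sval p.2 : R)).
    by apply: continuous_snd; exact: I01_val_continuous.
  have cb : continuous (fun z : Ball R n.+1 * (T * I01 R) => sval z.1 : 'rV[R]_n.+1).
    by apply: continuous_fst; exact: ball_val_continuous.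
  have ce : continuous (fun z : Ball R n.+1 * (T * I01 R) => enorm (sval z.1)).
    exact: (continuous_compose (@enorm_continuous R n.+1) cb).
  have ct : continuous (fun z : Ball R n.+1 * (T * I01 R) => z.2.1).
    by apply: (@continuous_snd _ _ _ (fun p : T * I01 R => p.1)) => p; exact: cvg_fst.
  have cst : continuous (fun z : Ball R n.+1 * (T * I01 R) =>
      stretch (sval z.1) (sval z.2.2)).
    apply: cont_min.
      apply: cont_mul; last exact: cst_continuous.
      apply: (@cont_add R _ R^o); first exact: cst_continuous.
      by apply: cont_mul => //; exact: cst_continuous.
    apply: cont_mul.
      by apply: (@cont_add R _ R^o) => //; exact: cst_continuous.
    apply: cont_inv.
      move=> z; rewrite gt_eqF // mulr_gt0 // lt_max; apply/orP; right; lra.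
    apply: cont_mul; first exact: cst_continuous.
    by apply: cont_max => //; exact: cst_continuous.
  apply: (continuous_compose ch); apply: continuous_pair.
    apply: continuous_pair => //.
    by apply: (continuous_compose (@retract_continuous R n.+1)); exact: cont_scale.
  apply: (continuous_compose (@clampI_continuous R)); apply: cont_mul => //.
  exact: (continuous_compose (@cutoff_continuous R n.+1) cb).
- move=> b t; rewrite /H /= mulr0 clampI0 // stretch0 ?ball_enorm // h0 /collar /=.
  have b1 := ball_enorm b.
  have eb : enorm ((1 / 2) *: sval b) <= 1 / 2.
    by rewrite enormZ ger0_norm //; lra.
  rewrite -[_ *: ((1 / 2) *: _)]/(sval (retract ((1 / 2) *: sval b))).
  rewrite retract_val; last by apply: le_trans eb _; lra.
  rewrite eb; congr (F (_, t)); apply: ball_inj.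
  have e2 : 2 *: ((1 / 2) *: sval b) = sval b.
    by rewrite scalerA (_ : 2 * (1 / 2) = 1) ?scale1r //; lra.
  by rewrite e2 retract_val.
- move=> s [t u]; have /andP[u0 u1] := I01_itv u; have s1 := sphere_enorm s.
  rewrite /H /= cutoff_sphere // mul0r clampI0 // h0 stretch_sphere //.
  set b := retract _.
  have eb : sval b = ((1 + sval u) / 2) *: sval s.
    by rewrite retract_val // enormZ s1 ger0_norm; lra.
  have nb : enorm (sval b) = (1 + sval u) / 2.
    by rewrite eb enormZ s1 mulr1 ger0_norm //; lra.
  rewrite collar_outer; last by rewrite nb; lra.
  rewrite nb eb direction_sphere; last lra.
  by congr (G (s, (t, _))); rewrite -[RHS]clampI_id; congr clampI; lra.
- move=> b t; rewrite /H /= mulr1.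
  have [b2|/ltW b2] := leP (enorm (sval b)) (1 / 2).
    by rewrite cutoff_half // clampI1.
  rewrite stretch1 //; set b' := retract _.
  have b0 : 0 < enorm (sval b) by lra.
  have nb : enorm ((enorm (sval b))^-1 *: sval b) = 1.
    by rewrite enormZ gtr0_norm ?invr_gt0 // mulVf // gt_eqF.
  have eb : sval b' = (enorm (sval b))^-1 *: sval b.
    by rewrite retract_val // nb.
  have cK : cw_skeleton K N (collar (b', t)).
    rewrite collar_outer eb nb; last lra.
    by rewrite clampI1 //; lra.
  by rewrite hrel.
- move=> b t u At; rewrite /H /=; set b' := retract _.
  have cK : cw_skeleton K N (collar (b', t)).
    by rewrite /collar; case: ifP => _ /=; [exact: FA|exact: GA].
  by rewrite hrel.
Qed.

End cell_homotopy.

(** * Equivariant deformation of a projective complex *)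

Section projective_section.
Variables (M : monoidType) (P : monoid_set M).

(** The disjoint union of copies of [M] indexed by [P]. *)
Let free_act (a : M) (p : M * P) : M * P := (a * p.1, p.2)%g.

Lemma free_act1 p : free_act 1%g p = p.
Proof. by case: p => b x; rewrite /free_act mul1g. Qed.

Lemma free_actM a b p : free_act (a * b)%g p = free_act a (free_act b p).
Proof. by case: p => c x; rewrite /free_act mulgA. Qed.

Definition free_cover : monoid_set M :=
  @MonoidSet M (M * P)%type free_act free_act1 free_actM.

(** A section of the surjection [(a, p) |-> a p] from a free [M]-set. It replaces
    the decomposition of [P] as a disjoint union of sets [M e]: the element [p]
    is the translate by [c p] of the representative [u p] of its piece, and
    choices made for the representatives are carried to all of [P] by
    translation. *)
Lemma projective_coordinates : projective P ->
  exists (c : P -> M) (u : P -> P), [/\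
    forall p, mset_act (c p) (u p) = p,
    forall a p, c (mset_act a p) = (a * c p)%g &
    forall a p, u (mset_act a p) = u p].
Proof.
move=> projP.
have [||s ms sK] := projP free_cover (fun p => mset_act p.1 p.2).
- by move=> a p; rewrite /= mset_actM.
- by move=> p; exists (1%g, p); rewrite /= mset_act1.
exists (fun p => (s p).1), (fun p => (s p).2); split => // a p.
- by rewrite ms.
- by rewrite ms.
Qed.

End projective_section.

Lemma mspace_act_cont (M : monoidType) (Y : mspace M) (a : M) :
  continuous (@mspace_act M Y a).
Proof.
apply: (continuous_compose (@mspace_act_continuous M Y)
  (f := fun y : Y => (a : discrete_topology M, y))).
by apply: continuous_pair; [exact: cst_continuous|exact: continuous_idfun].
Qed.

Section equivariant_deformation.
Variables (R : realType) (M : monoidType) (X Y : mspace M).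
Variables (KX : projective_mcw_complex R X) (KY : cw_complex R Y).
Hypothesis Y_cellular : forall a : M,
  cellular (cw_skeleton KY) (cw_skeleton KY) (@mspace_act M Y a).
Variables (T : topologicalType) (l : nat) (jT : T -> 'rV[R]_l).
Hypothesis cptT : compact [set: T].
Hypothesis cjT : continuous jT.
Hypothesis ijT : injective jT.
Variables (A : set T) (F : X * T -> Y).
Hypothesis cF : continuous F.
Hypothesis eF : forall a x t, F (mspace_act a x, t) = mspace_act a (F (x, t)).
Hypothesis FA : forall n x t, mcw_skeleton KX n x -> A t ->
  cw_skeleton KY (n + l) (F (x, t)).

Local Notation skel := (mcw_skel_space KX).
Local Notation incl n := (@mcw_incl R M X KX n).
Local Notation V := (T * I01 R)%type.

Lemma act_skeleton a n y : cw_skeleton KY n y -> cw_skeleton KY n (mspace_act a y).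
Proof. by move=> yn; apply: (Y_cellular (a := a)); exists y. Qed.

(** A homotopy on the [n]-skeleton of [X], with a parameter in [T], from [F] to
    a map whose values at the time 1 lie in the right skeleton. Over [A] the
    skeleton is never left, which is what makes the homotopies at the two
    ends of a cylinder cellular. *)
Definition deformation n (Phi : skel n * V -> Y) : Prop :=
  [/\ continuous Phi,
    forall a x v, Phi (mspace_act a x, v) = mspace_act a (Phi (x, v)),
    forall x t, Phi (x, (t, I0 R)) = F (incl n x, t),
    forall x t, cw_skeleton KY (n + l) (Phi (x, (t, I1 R))) &
    forall x t s, A t -> cw_skeleton KY (n + l) (Phi (x, (t, s)))].

Lemma V_compact : compact [set: V].
Proof. exact: compact_prod cptT (@I01_compact R). Qed.

Lemma V_locally_compact : locally_compact [set: V].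
Proof. exact: compact_locally_compact V_compact. Qed.

Lemma V_hausdorff : hausdorff_space V.
Proof.
apply: hausdorff_prod; last exact: I01_hausdorff.
exact: (hausdorff_injective cjT ijT (@norm_hausdorff _ _)).
Qed.

Lemma mcw_incl_map n : mspace_map (incl n).
Proof. by have [_ [h _]] := @mcw_colimit R M X KX; exact: h. Qed.

Lemma mcw_incl_step n x : incl n.+1 (mcw_step x) = incl n x.
Proof.
have [_ [_ [st _]]] := @mcw_colimit R M X KX.
exact: (congr1 (fun h => h x) (st n)).
Qed.

(** For a single vertex, this compresses a map defined on [T] alone. *)
Lemma deformation0 : exists Phi, @deformation 0 Phi.
Proof.
have [c [u [cu cM uM]]] := projective_coordinates (@mcw_cells_projective R M X KX 0).
have [[cb eb] [g [cg eg] [bK gK]]] := @mcw_baseP R M X KX.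
have /(_ _)/cid-/all_sig[h hP] (p : mcw_cells KX 0) :=
  @compress R Y KY T l jT cptT cjT ijT l
    (fun t => F (incl 0 (mcw_base (p : discrete_topology _)), t)) (leqnn l)
    (continuous_compose cF (continuous_pair (@cst_continuous _ _ _) (@continuous_idfun T))).
pose Psi (z : discrete_topology (mcw_cells KX 0) * V) : Y :=
  mspace_act (c z.1) (h (u z.1) z.2).
have cPsi : continuous Psi.
  apply: discrete_prod_continuous => p.
  apply: (continuous_compose (@mspace_act_cont M Y (c p))).
  by case: (hP (u p)).
exists (fun z => Psi (g z.1, z.2)); split.
- apply: (continuous_compose cPsi); apply: continuous_pair; last by move=> z; exact: cvg_snd.
  exact: continuous_fst.
- by move=> a x v; rewrite /Psi /= eg /= cM uM mspace_actM.
- move=> x t; rewrite /Psi /=; case: (hP (u (g x))) => _ -> _ _.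
  have -> : incl 0 x = mspace_act (c (g x)) (incl 0 (mcw_base (u (g x) : discrete_topology _))).
    rewrite -(mcw_incl_map 0).2 -eb; congr (incl 0 _).
    by rewrite /= cu gK.
  by rewrite eF.
- move=> x t; rewrite /Psi /=; case: (hP (u (g x))) => _ _ h1 _.
  exact: act_skeleton.
- move=> x t s At; rewrite /Psi /=; case: (hP (u (g x))) => _ _ _ hrel.
  have FAx : cw_skeleton KY l (F (incl 0 (mcw_base (u (g x) : discrete_topology _)), t)).
    by apply: (@FA 0) => //; exists (mcw_base (u (g x) : discrete_topology _)).
  by apply: act_skeleton; rewrite hrel.
Qed.

(** On the cell indexed by [p], the homotopy is the translate by [c p] of a
    homotopy chosen for the representative [u p]. It is well defined and
    equivariant because [c] and [u] are, and it extends [Phi] because [Phi]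
    and the attaching maps are equivariant; it reaches the right
    skeleton because [M] acts by cellular maps. *)
Lemma deformationS n (Phi : skel n * V -> Y) : deformation Phi ->
  exists2 Phi' : skel n.+1 * V -> Y, deformation Phi' &
    forall x v, Phi' (mcw_step x, v) = Phi (x, v).
Proof.
move=> [cPhi ePhi Phi0 Phi1 PhiA].
have [c [u [cu cM uM]]] := projective_coordinates (@mcw_cells_projective R M X KX n.+1).
have po := @mcw_pushout R M X KX n; have tpo := forget_pushout po.
have [[_ [catt eatt] [cstep estep] [cchar echar]] [sq _]] := po.
have attE q : mcw_step (mcw_attach q) = mcw_char (cell_incl q) :> skel n.+1.
  exact: (congr1 (fun h => h q) sq).
have lenn : (n + l <= n.+1 + l)%N by rewrite leq_add2r.
have cpair (Z B : topologicalType) (p : mcw_cells KX n.+1)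
    (k : discrete_topology (mcw_cells KX n.+1) * B -> Z) :
    continuous k -> continuous (fun b => k (p : discrete_topology _, b)).
  move=> ck; apply: (continuous_compose ck).
  by apply: continuous_pair; [exact: cst_continuous|exact: continuous_idfun].
pose cell p b : X := incl n.+1 (mcw_char (p : discrete_topology (mcw_cells KX n.+1), b)).
have ccell p : continuous (cell p).
  apply: (continuous_compose (mcw_incl_map n.+1).1).
  exact: (cpair _ _ p _ cchar).
pose Fp p (z : Ball R n.+1 * T) := F (cell p z.1, z.2).
pose Gp p (z : Sphere R n.+1 * V) :=
  Phi (mcw_attach (p : discrete_topology (mcw_cells KX n.+1), z.1), z.2).
have /(_ _)/cid-/all_sig[H HP] (p : mcw_cells KX n.+1) :
    exists H : Ball R n.+1 * V -> Y,
  [/\ continuous H, forall b t, H (b, (t, I0 R)) = Fp p (b, t),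
      forall s v, H (sphere_incl s, v) = Gp p (s, v),
      forall b t, cw_skeleton KY (n.+1 + l) (H (b, (t, I1 R))) &
      forall b t s, A t -> cw_skeleton KY (n.+1 + l) (H (b, (t, s)))].
  apply: (@cell_homotopy R Y KY T l jT cptT cjT ijT A n (n.+1 + l) (leqnn _)
    (Fp p) (Gp p)).
  - apply: (continuous_compose cF); apply: continuous_pair; last by move=> z; exact: cvg_snd.
    exact: continuous_fst.
  - apply: (continuous_compose cPhi); apply: continuous_pair; last by move=> z; exact: cvg_snd.
    exact: (continuous_fst (cpair _ (Sphere R n.+1) p _ catt)).
  - move=> s t; rewrite /Gp /Fp Phi0 /cell; congr (F (_, t)).
    by rewrite -mcw_incl_step attE.
  - by move=> s t; apply: cw_skeleton_mono lenn _ _; exact: Phi1.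
  - by move=> b t At; apply: FA => //; exists (mcw_char (p : discrete_topology _, b)).
  - by move=> s t r At; apply: cw_skeleton_mono lenn _ _; exact: PhiA.
pose Psi (z : (discrete_topology (mcw_cells KX n.+1) * Ball R n.+1) * V) : Y :=
  mspace_act (c z.1.1) (H (u z.1.1) (z.1.2, z.2)).
have cPsi : continuous Psi.
  pose Psi' (z : discrete_topology (mcw_cells KX n.+1) * (Ball R n.+1 * V)) : Y :=
    mspace_act (c z.1) (H (u z.1) z.2).
  have cPsi' : continuous Psi'.
    apply: discrete_prod_continuous => p.
    apply: (continuous_compose (@mspace_act_cont M Y (c p))).
    by case: (HP (u p)).
  apply: (continuous_compose cPsi' (f := fun z : (discrete_topology
    (mcw_cells KX n.+1) * Ball R n.+1) * V => (z.1.1, (z.1.2, z.2)))).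
  apply: continuous_pair.
    by apply: continuous_fst => z; exact: cvg_fst.
  apply: continuous_pair; last by move=> z; exact: cvg_snd.
  by apply: continuous_fst => z; exact: cvg_snd.
have [|W [cW Wstep Wchar]] := pushout_times V_locally_compact V_hausdorff tpo cPhi cPsi.
  move=> [p s] v; rewrite /Psi /=; case: (HP (u p)) => _ _ -> _ _.
  rewrite /Gp -ePhi /=; congr (Phi (_, v)).
  by rewrite -eatt /= /prod_act /= cu.
have cover := pushout_cover tpo.
exists W; last exact: Wstep.
split => //.
- move=> a x v; have [[x' ->]|[[p b] ->]] := cover x.
    by rewrite -estep !Wstep ePhi.
  by rewrite -echar !Wchar /Psi /= cM uM mspace_actM.
- move=> x t; have [[x' ->]|[[p b] ->]] := cover x.
    by rewrite Wstep Phi0 mcw_incl_step.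
  rewrite Wchar /Psi /=; case: (HP (u p)) => _ -> _ _ _.
  rewrite /Fp -eF /cell; congr (F (_, t)).
  rewrite -(mcw_incl_map n.+1).2 -echar; congr (incl n.+1 (mcw_char _)).
  by rewrite /= /prod_act /= cu.
- move=> x t; have [[x' ->]|[[p b] ->]] := cover x.
    by rewrite Wstep; apply: cw_skeleton_mono lenn _ _; exact: Phi1.
  by rewrite Wchar /Psi /=; case: (HP (u p)) => _ _ _ h _; exact: act_skeleton.
- move=> x t s At; have [[x' ->]|[[p b] ->]] := cover x.
    by rewrite Wstep; apply: cw_skeleton_mono lenn _ _; exact: PhiA.
  by rewrite Wchar /Psi /=; case: (HP (u p)) => _ _ _ _ h; apply: act_skeleton; exact: h.
Qed.

(** Cellular approximation with parameters: [T] is a point for the existence of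
    approximations, and an interval for their uniqueness. *)
Lemma equivariant_deformation : exists Phi : X * V -> Y, [/\ continuous Phi,
    forall a x v, Phi (mspace_act a x, v) = mspace_act a (Phi (x, v)),
    forall x t, Phi (x, (t, I0 R)) = F (x, t),
    forall n x t, mcw_skeleton KX n x -> cw_skeleton KY (n + l) (Phi (x, (t, I1 R))) &
    forall n x t s, mcw_skeleton KX n x -> A t ->
      cw_skeleton KY (n + l) (Phi (x, (t, s)))].
Proof.
pose next n (Phi : {Phi | @deformation n Phi}) : {Phi | @deformation n.+1 Phi} :=
  let w := cid2 (deformationS (svalP Phi)) in exist _ (s2val w) (s2valP w).
pose U := fix U n : {Phi | @deformation n Phi} :=
  if n is m.+1 then next m (U m) else cid deformation0.
have US n x v : sval (U n.+1) (mcw_step x, v) = sval (U n) (x, v).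
  exact: (s2valP' (cid2 (deformationS (svalP (U n))))).
have tco := forget_colimit (@mcw_colimit R M X KX).
have [|//|W [cW WE]] := colimit_times V_locally_compact V_hausdorff tco
  (u := fun n => sval (U n)).
  by move=> n; case: (svalP (U n)).
exists W; split => //.
- move=> a x v; have [n [y ->]] := colimit_cover tco x.
  by rewrite -(mcw_incl_map n).2 !WE; case: (svalP (U n)).
- move=> x t; have [n [y ->]] := colimit_cover tco x.
  by rewrite WE; case: (svalP (U n)).
- by move=> n _ t [y _ <-]; rewrite WE; case: (svalP (U n)).
- by move=> n _ t s [y _ <-] At; rewrite WE; case: (svalP (U n)) => _ _ _ _; apply.
Qed.

End equivariant_deformation.

(** * Cellular approximation *)

Section homotopy_calculus.
Variables (R : realType) (M : monoidType) (X Y : mspace M).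

Lemma is_mhomotopyE (f g : X -> Y) (H : cylinder R X -> Y) :
  is_mhomotopy f g H <-> [/\ continuous (H : X * I01 R -> Y),
    forall a x t, H (mspace_act a x, t) = mspace_act a (H (x, t)),
    forall x, H (x, I0 R) = f x & forall x, H (x, I1 R) = g x].
Proof.
split=> [[[cH eH] H0 H1]|[cH eH H0 H1]]; split => //.
  by move=> a x t; exact: (eH a (x, t)).
by split => // a [x t]; exact: eH.
Qed.

Definition reverseI (t : I01 R) : I01 R := clampI (1 - sval t).

Lemma reverse_mhomotopy (f g : X -> Y) (H : cylinder R X -> Y) :
  is_mhomotopy f g H ->
  is_mhomotopy g f (fun p : cylinder R X => H (p.1, reverseI p.2)).
Proof.
move=> /is_mhomotopyE[cH eH H0 H1]; apply/is_mhomotopyE; split => [|a x t|x|x].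
- apply: (continuous_compose cH); apply: continuous_pair; first by move=> z; exact: cvg_fst.
  apply: (continuous_compose (@clampI_continuous R)).
  apply: (@cont_sub R _ R^o); first exact: cst_continuous.
  exact: (continuous_snd (@I01_val_continuous R)).
- exact: eH.
- by rewrite /= /reverseI clampI1 //= subr0.
- by rewrite /= /reverseI clampI0 //= subrr.
Qed.

Lemma concat_mhomotopy (f g h : X -> Y) (H1 H2 : cylinder R X -> Y) :
  is_mhomotopy f g H1 -> is_mhomotopy g h H2 ->
  is_mhomotopy f h (concat H1 H2 : cylinder R X -> Y).
Proof.
move=> /is_mhomotopyE[c1 e1 H10 H11] /is_mhomotopyE[c2 e2 H20 H21].
apply/is_mhomotopyE; split => [|a x t|x|x].
- by apply: concat_continuous => // x; rewrite H11 H20.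
- by rewrite /concat /=; case: ifP => _; [exact: e1|exact: e2].
- by rewrite concat0.
- by rewrite concat1.
Qed.

End homotopy_calculus.

Theorem theorem2p8 (R : realType) (M : monoidType) (X Y : mspace M)
    (KX : projective_mcw_complex R X) (KY : cw_complex R Y)
    (Y_cellular : forall a : M,
       cellular (cw_skeleton KY) (cw_skeleton KY) (@mspace_act M Y a))
    (f : X -> Y) (f_map : mspace_map f) :
  (exists g : X -> Y, cellular_approximation KX KY f g) /\
  (forall g0 g1 : X -> Y,
     cellular_approximation KX KY f g0 -> cellular_approximation KX KY f g1 ->
     exists2 H : cylinder R X -> Y, is_mhomotopy g0 g1 H &
       cellular (prod_skeleton (mcw_skeleton KX) (@I_skeleton R))
         (cw_skeleton KY) H).
Proof.
have [cf ef] := f_map; split.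
  pose T : topologicalType := discrete_topology unit.
  pose jT (t : T) : 'rV[R]_0 := 0.
  have cptT : compact [set: T].
    rewrite (_ : [set: T] = [set tt]); first exact: compact_set1.
    by apply/seteqP; split => // -[].
  have ijT : injective jT by move=> [] [].
  have [||//|Phi [cPhi ePhi Phi0 Phi1 _]] := @equivariant_deformation R M X Y KX KY Y_cellular
    T 0 jT cptT (@cst_continuous _ _ _) ijT set0 (fun p => f p.1) _ _ _.
  - exact: continuous_fst.
  - by move=> a x t; exact: ef.
  have cv s : continuous (fun x : X => Phi (x, (tt : T, s))).
    apply: (continuous_compose cPhi).
    by apply: continuous_pair; [exact: continuous_idfun|exact: cst_continuous].
  exists (fun x => Phi (x, (tt, I1 R))); split.
  - by split => [|a x]; [exact: cv|exact: ePhi].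
  - by move=> n _ [x xn <-]; have := Phi1 n x tt xn; rewrite addn0.
  exists (fun p => Phi (p.1, (tt, p.2))); apply/is_mhomotopyE; split => [|a x t|x|//].
  - apply: (continuous_compose cPhi); apply: continuous_pair; first by move=> z; exact: cvg_fst.
    by apply: continuous_pair; [exact: cst_continuous|move=> z; exact: cvg_snd].
  - exact: ePhi.
  - by rewrite Phi0.
move=> g0 g1 [_ g0c [H0 H0P]] [_ g1c [H1 H1P]].
have HP := concat_mhomotopy (reverse_mhomotopy H0P) H1P.
move: (concat _ _) HP => H /[dup] HP /is_mhomotopyE[cH eH Hg0 Hg1].
pose jI (t : I01 R) : 'rV[R]_1 := const_mx (sval t).
have cjI : continuous jI.
  apply: rV_continuous => i.
  rewrite (_ : (fun t => jI t 0 i) = (fun t : I01 R => sval t)).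
    exact: I01_val_continuous.
  by apply/funext => t; rewrite mxE.
have ijI : injective jI.
  by move=> s t /matrixP/(_ 0 0); rewrite !mxE => st; exact: I01_inj.
have [|Phi [cPhi ePhi Phi0 Phi1 PhiA]] := @equivariant_deformation R M X Y KX KY Y_cellular
  (I01 R) 1 jI (@I01_compact R) cjI ijI [set I0 R; I1 R] H cH eH.
  move=> n x t xn At; apply: (@cw_skeleton_mono _ _ KY n); first exact: leq_addr.
  by case: At => ->; rewrite ?Hg0 ?Hg1; [apply: g0c|apply: g1c]; exists x.
have side t : is_mhomotopy (fun x => H (x, t)) (fun x => Phi (x, (t, I1 R)))
    (fun p : cylinder R X => Phi (p.1, (t, p.2))).
  apply/is_mhomotopyE; split => [|a x s|x|//]; [|exact: ePhi|exact: Phi0].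
  apply: (continuous_compose cPhi); apply: continuous_pair; first by move=> z; exact: cvg_fst.
  by apply: continuous_pair; [exact: cst_continuous|move=> z; exact: cvg_snd].
have top : is_mhomotopy (fun x => Phi (x, (I0 R, I1 R))) (fun x => Phi (x, (I1 R, I1 R)))
    (fun p : cylinder R X => Phi (p.1, (p.2, I1 R))).
  apply/is_mhomotopyE; split => [|a x s|//|//]; last exact: ePhi.
  apply: (continuous_compose cPhi); apply: continuous_pair; first by move=> z; exact: cvg_fst.
  by apply: continuous_pair; [move=> z; exact: cvg_snd|exact: cst_continuous].
(* Deforming [H] moves its ends. The moves of the ends stay in the skeleton,
   so they can be prepended and appended to the deformed homotopy. *)
have s0 := side (I0 R); have s1 := reverse_mhomotopy (side (I1 R)).
have C := concat_mhomotopy (concat_mhomotopy s0 top) s1.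
(* The three parts stay one dimension above the skeleton of [x], as the
   cells of the interval require. *)
move: C; set H3 := concat _ _ => /is_mhomotopyE[cH3 eH3 H30 H31].
have H3n n x t : mcw_skeleton KX n x -> cw_skeleton KY n.+1 (H3 (x, t)).
  move=> xn; rewrite -addn1; apply: concat_ind => s /=.
    by apply: concat_ind => r /=; [apply: PhiA => //; left|exact: Phi1].
  by apply: PhiA => //; right.
exists H3.
  by apply/is_mhomotopyE; split => // x; rewrite ?H30 ?H31 ?Hg0 ?Hg1.
move=> n _ [[x t] [k /= kn [/= xk tk]] <-].
move: tk; rewrite /I_skeleton; case E: (n - k)%N => [|r] tk; last first.
  apply: cw_skeleton_mono (H3n k x t xk).
  by rewrite -subn_gt0 E.
have {E kn}kn : k = n by apply/eqP; rewrite eqn_leq kn -subn_eq0 E.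
rewrite kn in xk; case: tk => ->.
  by rewrite H30 Hg0; apply: g0c; exists x.
by rewrite H31 Hg1; apply: g1c; exists x.
Qed.
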